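(* Let $d\geq 2$, $1\leq k\leq d-1$, let $A\subset\mathbb{R}^d$ have positive reach and let $a\in T_k(A)$. Then there exist $\delta>0$ and a $k$-dimensional $C^{1,1}$ surface $\Gamma\subset\mathbb{R}^d$ such that $T_k(A)\cap B(a,\delta)\subset\Gamma$.
   Context: A set $A\subset\mathbb{R}^d$ has positive reach if there is $\varepsilon>0$ such that every $x$ with $\mathrm{dist}(x,A)<\varepsilon$ has a unique nearest point in $A$. $\operatorname{Tan}(A,x)$ is the tangent cone ($u\in\operatorname{Tan}(A,x)$ iff $u=0$ or $r_i(x_i-x)\to u$ for some $x\neq x_i\in A$, $x_i\to x$, $r_i>0$), and $T_k(A)$ is the set of $x\in A$ with $\dim\operatorname{span}\operatorname{Tan}(A,x)=k$. A $k$-dimensional $C^{1,1}$ surface ($0<k<d$) is a set $\{w+\varphi(w):w\in W\}$ where $W$ is a $k$-dimensional linear subspace of $\mathbb{R}^d$ and $\varphi:W\to W^\perp$ is a $C^{1,1}$ mapping (differentiable with Lipschitz derivative). *)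

(* Defs.v *)
From HB Require Import structures.
From mathcomp Require Import all_boot all_order all_algebra.
From mathcomp Require Import all_classical all_reals all_analysis.
Set Implicit Arguments. Unset Strict Implicit. Unset Printing Implicit Defensive.
Import Order.TTheory GRing.Theory Num.Theory.
Import numFieldNormedType.Exports.
Local Open Scope classical_set_scope.
Local Open Scope ring_scope.

Section Defs.
Variable R : realType.

Definition enorm (n : nat) (x : 'rV[R]_n) : R :=
  Num.sqrt (\sum_(i < n) (x ord0 i) ^+ 2).

Definition eball (n : nat) (a : 'rV[R]_n) (r : R) : set 'rV[R]_n :=
  [set x | enorm (x - a) < r].

Definition seq_cvg (n : nat) (u : nat -> 'rV[R]_n) (l : 'rV[R]_n) : Prop :=
  forall e : R, 0 < e -> exists N : nat, forall m, (N <= m)%N -> enorm (u m - l) < e.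

Definition positive_reach (d : nat) (A : set 'rV[R]_d) : Prop :=
  exists eps : R, 0 < eps /\
    forall x : 'rV[R]_d, (exists q, A q /\ enorm (x - q) < eps) ->
      exists p, (A p /\ forall q, A q -> enorm (x - p) <= enorm (x - q)) /\
        forall p', (A p' /\ forall q, A q -> enorm (x - p') <= enorm (x - q)) -> p' = p.

Definition Tan (d : nat) (A : set 'rV[R]_d) (x : 'rV[R]_d) : set 'rV[R]_d :=
  [set u | u = 0 \/
     exists (xs : nat -> 'rV[R]_d) (r : nat -> R),
       (forall i, A (xs i) /\ xs i != x /\ 0 < r i) /\
       seq_cvg xs x /\ seq_cvg (fun i => r i *: (xs i - x)) u].

Definition span_dim (d : nat) (S : set 'rV[R]_d) (k : nat) : Prop :=
  exists M : 'M[R]_(k, d),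
    [/\ row_free M,
        (forall u, S u -> (u <= M)%MS) &
        (forall m (N : 'M[R]_(m, d)), (forall u, S u -> (u <= N)%MS) -> (M <= N)%MS)].

Definition T_k (d : nat) (A : set 'rV[R]_d) (k : nat) : set 'rV[R]_d :=
  [set x | A x /\ span_dim (Tan A x) k].

Definition C11 (k d : nat) (f : 'rV[R]_k -> 'rV[R]_d) : Prop :=
  (forall v, differentiable f v) /\
  exists L : R, forall v w h : 'rV[R]_k,
    enorm ('d f v h - 'd f w h) <= L * enorm (v - w) * enorm h.

(* k-dimensional C^{1,1} surface {w + phi w : w in W}.  W is given by an
   orthonormal basis B (rows), so W = {v *m B | v in R^k}; phi : W -> W^perp
   is represented through this linear isometry R^k ~ W as psi v = phi (v *m B). *)
Definition C11_surface (d k : nat) (G : set 'rV[R]_d) : Prop :=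
  exists (B : 'M[R]_(k, d)) (psi : 'rV[R]_k -> 'rV[R]_d),
    [/\ B *m B^T = 1%:M,
        (forall v, psi v *m B^T = 0),
        C11 psi &
        G = [set y | exists v : 'rV[R]_k, y = v *m B + psi v]].

End Defs.

(* Main.v *)
Require Import Defs.
From HB Require Import structures.
From mathcomp Require Import all_boot all_order all_algebra.
From mathcomp Require Import all_classical all_reals all_analysis.
From mathcomp Require Import ring lra.
Import Order.TTheory GRing.Theory Num.Theory.
Import numFieldNormedType.Exports.
Local Open Scope classical_set_scope.
Local Open Scope ring_scope.
Set Implicit Arguments.
Unset Strict Implicit.
Unset Printing Implicit Defensive.

(** Uniqueness of nearest points makes the distance function grow at unit speed
    along z - proj z, hence normals of length eps / 2 are still normals. For x, y
    in A this bounds the distance from a point x + t (y - x) of the segment to A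
    by (2 / eps) t |y - x|^2; letting t tend to 0, y - x is within
    (2 / eps) |y - x|^2 of Tan(A, x).

    Let u_1, ..., u_k in Tan(A, a) be a basis of its span. The segment estimate
    gives, for x in A near a and every small s, points q_i of A with
    q_i - x close to s u_i. If x and y are in T_k(A) and s = |x - y|, all the
    q_i - x are O(s^2)-close to both tangent spans, so the two spans are at
    distance O(s). Over a coordinate k-plane to which the span at a projects
    isomorphically, T_k(A) is therefore locally a graph carrying a C^{1,1} jet.

    A scalar C^{1,1} jet is extended explicitly: with H the largest convex minorant
    of the paraboloids f_z + g_z (p - e_z) + m |p - e_z|^2 + m |p|^2, the function
    (H (p + h) + H (p - h)) / 2 - 2 m |h|^2 is again a convex minorant, so H has
    bounded second differences, and H - m |p|^2 is the extension. *)

(** * Euclidean norm *)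

Section Euclid.
Variables (R : realType) (n : nat).
Implicit Types (x y z : 'rV[R]_n) (c : R).

Definition dot x y : R := \sum_i x ord0 i * y ord0 i.

Lemma dotC x y : dot x y = dot y x.
Proof. by apply: eq_bigr => i _; rewrite mulrC. Qed.

Lemma dotDl x y z : dot (x + y) z = dot x z + dot y z.
Proof. by rewrite -big_split; apply: eq_bigr => i _; rewrite !mxE mulrDl. Qed.

Lemma dotDr x y z : dot z (x + y) = dot z x + dot z y.
Proof. by rewrite dotC dotDl !(dotC z). Qed.

Lemma dotZl c x z : dot (c *: x) z = c * dot x z.
Proof. by rewrite mulr_sumr; apply: eq_bigr => i _; rewrite !mxE mulrA. Qed.

Lemma dotZr c x z : dot z (c *: x) = c * dot z x.
Proof. by rewrite dotC dotZl dotC. Qed.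

Lemma dotNl x z : dot (- x) z = - dot x z.
Proof. by rewrite -scaleN1r dotZl mulN1r. Qed.

Lemma dotNr x z : dot z (- x) = - dot z x.
Proof. by rewrite dotC dotNl dotC. Qed.

Definition dotE := (dotDl, dotDr, dotNl, dotNr, dotZl, dotZr).

Lemma dot_sqrD x y : dot (x + y) (x + y) = dot x x + 2 * dot x y + dot y y.
Proof. by rewrite dotDl !dotDr (dotC y x); ring. Qed.

Lemma dot_sqrB x y : dot (x - y) (x - y) = dot x x - 2 * dot x y + dot y y.
Proof. by rewrite dot_sqrD !dotNl !dotNr; ring. Qed.

Lemma dot_ge0 x : 0 <= dot x x.
Proof. by apply: sumr_ge0 => i _; rewrite -expr2 sqr_ge0. Qed.

Lemma enorm_dot x : enorm x = Num.sqrt (dot x x).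
Proof. by congr Num.sqrt; apply: eq_bigr => i _; rewrite expr2. Qed.

Lemma enorm_ge0 x : 0 <= enorm x.
Proof. exact: sqrtr_ge0. Qed.

Lemma enorm_sqr x : enorm x ^+ 2 = dot x x.
Proof. by rewrite enorm_dot sqr_sqrtr ?dot_ge0. Qed.

Lemma enorm0 : enorm (0 : 'rV[R]_n) = 0.
Proof.
by rewrite enorm_dot /dot big1 ?sqrtr0 // => i _; rewrite mxE mul0r.
Qed.

Lemma coord_le_enorm x i : `|x ord0 i| <= enorm x.
Proof.
rewrite -sqrtr_sqr ler_wsqrtr // (bigD1 i) //= lerDl.
by apply: sumr_ge0 => j _; rewrite sqr_ge0.
Qed.

Lemma enorm_eq0 x : enorm x = 0 -> x = 0.
Proof.
move=> x0; apply/rowP => i; rewrite mxE; apply/eqP; rewrite -normr_le0 -x0.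
exact: coord_le_enorm.
Qed.

Lemma enorm_gt0 x : x != 0 -> 0 < enorm x.
Proof.
rewrite lt_neqAle enorm_ge0 andbT; apply: contraNneq => x0.
by apply/eqP/enorm_eq0.
Qed.

Lemma enormZ c x : enorm (c *: x) = `|c| * enorm x.
Proof.
by rewrite !enorm_dot dotZl dotZr mulrA -expr2 sqrtrM ?sqr_ge0 // sqrtr_sqr.
Qed.

Lemma enormN x : enorm (- x) = enorm x.
Proof. by rewrite -scaleN1r enormZ normrN1 mul1r. Qed.

Lemma enormC x y : enorm (x - y) = enorm (y - x).
Proof. by rewrite -enormN opprB. Qed.

Lemma dot_le x y : dot x y <= enorm x * enorm y.
Proof.
have [->|x0] := eqVneq x 0.
  by rewrite enorm0 mul0r /dot big1 // => i _; rewrite mxE mul0r.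
have ex := enorm_gt0 x0.
have := dot_ge0 (dot x y *: x - (enorm x ^+ 2) *: y).
rewrite !dotE (dotC y x) -!enorm_sqr => h.
rewrite real_leNgt ?num_real //; apply/negP => lt.
have l2 : (enorm x * enorm y) ^+ 2 < dot x y ^+ 2.
  by rewrite ltr_pXn2r // ?nnegrE ?mulr_ge0 ?enorm_ge0 // (le_trans _ (ltW lt)) ?mulr_ge0 ?enorm_ge0.
have : 0 < enorm x ^+ 2 * (dot x y ^+ 2 - (enorm x * enorm y) ^+ 2).
  by rewrite mulr_gt0 ?exprn_gt0 // subr_gt0.
by lra.
Qed.

Lemma enorm_le x c : 0 <= c -> dot x x <= c ^+ 2 -> enorm x <= c.
Proof.
by move=> c0; rewrite -enorm_sqr ler_pXn2r // ?nnegrE ?enorm_ge0.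
Qed.

Lemma enormD x y : enorm (x + y) <= enorm x + enorm y.
Proof.
apply: enorm_le; first by rewrite addr_ge0 ?enorm_ge0.
rewrite !dotE (dotC y x) -!enorm_sqr; have := dot_le x y; lra.
Qed.

Lemma enormB x y : enorm (x - y) <= enorm x + enorm y.
Proof. by rewrite -(enormN y) enormD. Qed.

Lemma enorm_dist y x z : enorm (x - z) <= enorm (x - y) + enorm (y - z).
Proof. by rewrite -(subrKA y) enormD. Qed.

Lemma enorm_le_sum x : enorm x <= \sum_i `|x ord0 i|.
Proof.
have s0 : 0 <= \sum_i `|x ord0 i| by exact: sumr_ge0.
apply: enorm_le => //; rewrite expr2 mulr_suml; apply: ler_sum => i _.
apply: (@le_trans _ _ (`|x ord0 i| * `|x ord0 i|)).
  by rewrite -normrM ler_norm.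
by rewrite ler_wpM2l // (bigD1 i) //= lerDl sumr_ge0.
Qed.

Lemma enorm_le_norm x : enorm x <= n%:R * `|x|.
Proof.
apply: (le_trans (enorm_le_sum x)).
rewrite mulr_natl -[X in _ *+ X]card_ord -sumr_const; apply: ler_sum => i _.
rewrite [leRHS]mx_normrE; exact: (@le_bigmax _ _ _ 0 (fun ij => `|x ij.1 ij.2|) (ord0, i)).
Qed.

Lemma norm_le_enorm x : `|x| <= enorm x.
Proof.
rewrite [leLHS]mx_normrE; apply/bigmax_leP; split=> [|[i j] _ /=]; first exact: enorm_ge0.
by rewrite ord1 coord_le_enorm.
Qed.

(** Bolzano-Weierstrass by compactness of a cube. The limit is a cluster point met at arbitrarily
    late indices, so no subsequence has to be extracted. *)
Lemma bounded_cluster (u : nat -> 'rV[R]_n) (C : R) :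
  (forall m, enorm (u m) <= C) ->
  exists l, forall e, 0 < e -> forall N, exists2 m, (N <= m)%N & enorm (u m - l) < e.
Proof.
move=> uC.
have := @rV_compact _ n (fun=> `[- C, C]%classic) (fun=> @segment_compact R _ _).
move=> /(_ (u @ \oo) _) [].
  exists 0%N => // m _ i /=; rewrite in_itv /= -ler_norml.
  exact: le_trans (coord_le_enorm _ _) (uC m).
move=> l [_ cl]; exists l => e e0 N.
(* The ball is taken in the sup norm, which bounds [enorm] up to the factor [n]; the added 1 keeps
   the divisor positive for [n = 0]. *)
have e1 : 0 < e / (n%:R + 1) by rewrite divr_gt0 // ltr_wpDl.
have [] := cl (u @` [set m | (N <= m)%N]) (ball l (e / (n%:R + 1))).
- by exists N => // m /= Nm; exists m.
- exact: nbhsx_ballx.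
- move=> _ [[m /= Nm <-]]; rewrite -ball_normE /= => lt; exists m => //.
  rewrite enormC; apply: le_lt_trans (enorm_le_norm _) _.
  move: lt; rewrite ltr_pdivlMr ?ltr_wpDl // => lt.
  apply: le_lt_trans lt; rewrite mulrC ler_wpM2l // lerDl //.
Qed.

End Euclid.

(** * Sets of positive reach *)

Lemma invS_lt (R : realType) (e : R) : 0 < e ->
  exists N : nat, forall m, (N <= m)%N -> m.+1%:R^-1 < e.
Proof.
move=> e0; have [N Ne] := @ltr_add_invr R 0 e e0; rewrite add0r in Ne.
exists N => m Nm; apply: le_lt_trans Ne.
by rewrite lef_pV2 ?posrE ?ltr0Sn // ler_nat ltnS.
Qed.

(** A cluster point of a maximising sequence is a maximiser. The Lipschitz bound is asked only
    inside the ball, since [dst] is controlled only in the tube. *)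
Lemma lipschitz_ball_max (R : realType) n (f : 'rV[R]_n -> R) (K s : R) x0 :
  0 <= s -> 0 <= K ->
  (forall x y, enorm (x - x0) <= s -> enorm (y - x0) <= s ->
     f x <= f y + K * enorm (x - y)) ->
  exists2 z, enorm (z - x0) <= s &
    forall y, enorm (y - x0) <= s -> f y <= f z.
Proof.
move=> s0 K0 fK; pose S := f @` [set y | enorm (y - x0) <= s].
have x00 : enorm (x0 - x0) <= s by rewrite subrr enorm0.
have hS : has_sup S.
  split; first by exists (f x0), x0.
  exists (f x0 + K * s) => _ [y /= ys <-].
  by apply: le_trans (fK y x0 ys x00) _; rewrite lerD2l ler_wpM2l.
have /choice[u uP] (m : nat) : exists y, enorm (y - x0) <= s /\ sup S - m.+1%:R^-1 < f y.
  have [|_ [y /= ys <-] lt] := @sup_adherent _ S m.+1%:R^-1 _ hS.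
    by rewrite invr_gt0.
  by exists y.
have [|l lP] := @bounded_cluster _ _ u (s + enorm x0).
  move=> m; rewrite -{1}(subrK x0 (u m)); apply: le_trans (enormD _ _) _.
  by rewrite lerD2r; case: (uP m).
have ls : enorm (l - x0) <= s.
  apply/ler_addgt0Pr => e e0; have [m _ me] := lP e e0 0%N.
  have := enorm_dist (u m) l x0; have [+ _] := uP m; rewrite (enormC l (u m)); lra.
exists l => // y ys; apply/ler_addgt0Pr => e e0.
have e1 : 0 < e / (K + 1) by rewrite divr_gt0 // ltr_wpDl.
have [N NP] := @invS_lt R (e / (K + 1)) e1.
have [m Nm me] := lP _ e1 N.
have [us lt] := uP m; have := NP m Nm.
have := fK _ _ us ls.
have : f y <= sup S by apply: sup_upper_bound => //; exists y.
have : K * enorm (u m - l) <= K * (e / (K + 1)) by rewrite ler_wpM2l // ltW.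
have : (K + 1) * (e / (K + 1)) = e by rewrite mulrC divfK // gt_eqF // ltr_wpDl.
move: lt; set i := m.+1%:R^-1; set E := e / (K + 1); clearbody i E; lra.
Qed.

Lemma ler_sqr2 (R : realType) (a b : R) : 0 <= a -> a <= b -> a ^+ 2 <= b ^+ 2.
Proof. by move=> a0 ab; rewrite ler_pXn2r // nnegrE (le_trans a0). Qed.

Lemma ltr_sqr2 (R : realType) (a b : R) : 0 <= b -> a ^+ 2 < b ^+ 2 -> a < b.
Proof.
move=> b0 ab; rewrite real_ltNge ?num_real //; apply/negP => /(ler_sqr2 b0).
by rewrite leNgt ab.
Qed.

(** * Distance function and nearest-point projection in the tube *)

Section Reach.
Variables (R : realType) (d : nat) (A : set 'rV[R]_d) (eps : R).
Hypothesis eps_gt0 : 0 < eps.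

Definition nearest (x p : 'rV[R]_d) :=
  A p /\ forall q, A q -> enorm (x - p) <= enorm (x - q).

Definition tube (x : 'rV[R]_d) := exists q, A q /\ enorm (x - q) < eps.

Variable proj : 'rV[R]_d -> 'rV[R]_d.
Hypothesis projP : forall x, tube x -> nearest x (proj x).
Hypothesis proj_unique : forall x p, tube x -> nearest x p -> p = proj x.

(** Inside the tube this is the distance to [A]; outside it [proj] is arbitrary. *)
Definition dst x := enorm (x - proj x).

Lemma dst_ge0 x : 0 <= dst x. Proof. exact: enorm_ge0. Qed.

Lemma dst_le x q : tube x -> A q -> dst x <= enorm (x - q).
Proof. by move=> /projP[_]; exact. Qed.

Lemma dst_lt x : tube x -> dst x < eps.
Proof. by move=> tx; have [q [Aq]] := tx; apply: le_lt_trans; apply: dst_le. Qed.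

Lemma tube_near x y : tube x -> dst x + enorm (y - x) < eps -> tube y.
Proof.
move=> tx xy; exists (proj x); split; first by have [] := projP tx.
by apply: le_lt_trans (enorm_dist x _ _) _; rewrite addrC.
Qed.

Lemma dst_lip x y : tube x -> tube y -> dst x <= dst y + enorm (x - y).
Proof.
move=> tx ty; apply: le_trans (dst_le tx (projP ty).1) _.
by apply: le_trans (enorm_dist y _ _) _; rewrite addrC.
Qed.

Lemma reach_closed l :
  (forall e, 0 < e -> exists2 q, A q & enorm (q - l) < e) -> A l.
Proof.
move=> lA; have tl : tube l.
  by have [q Aq ql] := lA _ eps_gt0; exists q; rewrite enormC.
have d0 : dst l = 0.
  apply/eqP; rewrite eq_le dst_ge0 andbT; apply/ler_addgt0Pr => e /lA[q Aq ql].
  by rewrite add0r (le_trans (dst_le tl Aq)) // enormC ltW.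
by move/enorm_eq0/eqP : d0; rewrite subr_eq0 => /eqP ->; have [] := projP tl.
Qed.

(** Otherwise there are points tending to [z] whose projections stay [e] away from [proj z]. A
    cluster point of these projections lies in [A], which is closed, and is nearest to [z];
    uniqueness makes it [proj z]. *)
Lemma proj_continuous z (e : R) : tube z -> 0 < e ->
  exists2 eta : R, 0 < eta &
    forall z', enorm (z' - z) < eta -> enorm (proj z' - proj z) < e.
Proof.
move=> tz e0; apply: contrapT => nex.
have dz := dst_lt tz.
have /choice[u uP] (m : nat) : exists z', [/\ enorm (z' - z) < m.+1%:R^-1,
    tube z' & e <= enorm (proj z' - proj z)].
  apply: contrapT => H; apply: nex.
  exists (Num.min (m.+1%:R^-1) (eps - dst z)) => [|z'].
    by rewrite lt_min subr_gt0 dz invr_gt0 ltr0Sn.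
  rewrite lt_min => /andP[z1 z2]; rewrite ltNge; apply/negP => ez.
  by apply: H; exists z'; split => //; apply: (tube_near tz); lra.
have [|l lP] := @bounded_cluster _ _ (proj \o u) (eps + 1 + enorm z).
  move=> m /=; have [u1 tu _] := uP m; have := dst_lt tu; rewrite /dst enormC.
  have : enorm (u m - z) < 1 by apply: lt_le_trans u1 _; rewrite invf_le1 // ler1n.
  have := enormD (proj (u m) - u m) (u m); rewrite subrK.
  have := enormD (u m - z) z; rewrite subrK; lra.
have nl : nearest z l.
  split.
    apply: reach_closed => e' e'0; have [m _ me] := lP _ e'0 0%N.
    by exists (proj (u m)) => //; have [_ /projP[]] := uP m.
  move=> q Aq; apply/ler_addgt0Pr => e' e'0.
  have e3 : 0 < e' / 3 by rewrite divr_gt0.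
  have [N NP] := invS_lt e3.
  have [m Nm me] := lP _ e3 N; rewrite /= in me.
  have [/lt_trans u1 tu _] := uP m; have {u1} := u1 _ (NP m Nm).
  have := dst_le tu Aq; rewrite /dst.
  have := enorm_dist (u m) z l; rewrite (enormC z (u m)).
  have := enorm_dist (proj (u m)) (u m) l.
  have := enorm_dist z (u m) q; lra.
have [m _ /=] := lP e e0 0%N; rewrite (proj_unique tz nl).
by have [_ _] := uP m; case: ltgtP.
Qed.

(** For [y] at distance [h] from [z] along [z - proj z], expand the square of (z - proj y) + (y -
    z). Here |z - proj y| >= dst z, and the cross term is [h * dst z] up to the small displacement
    of [proj y] from [proj z]. *)
Lemma dst_ascent z (c eta : R) : tube z -> 0 < dst z -> 0 <= c < 1 -> 0 < eta ->
  exists2 h : R, 0 < h < eta &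
    dst z + c * h < dst (z + (h / dst z) *: (z - proj z)).
Proof.
move=> tz z0 /andP[c0 c1] eta0; have dz := dst_lt tz.
(* With this tolerance for [proj], dst y ^ 2 is at least dst z ^ 2 + 2 c h dst z + h ^ 2, which
   exceeds (dst z + c h) ^ 2 as c < 1. *)
have e0 : 0 < (1 - c) * dst z by rewrite mulr_gt0 ?subr_gt0.
have [t t0 tP] := proj_continuous tz e0.
set h := Num.min (Num.min eta t) (eps - dst z) / 2.
have h0 : 0 < h by rewrite divr_gt0 // !lt_min eta0 t0 subr_gt0.
have : h < Num.min (Num.min eta t) (eps - dst z) by move: h0; rewrite /h; lra.
rewrite !lt_min => /andP[/andP[he ht] hz].
clearbody h.
exists h; first by rewrite h0.
set y := z + _.
have yz : y - z = (h / dst z) *: (z - proj z) by rewrite /y addrC addKr.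
clearbody y.
have nyz : enorm (y - z) = h.
  by rewrite yz enormZ gtr0_norm ?divr_gt0 // -/(dst z) divfK // gt_eqF.
have ty : tube y by apply: (tube_near tz); rewrite nyz; lra.
have pp : enorm (proj y - proj z) < (1 - c) * dst z by apply: tP; rewrite nyz.
have zy := dst_le tz (projP ty).1.
apply: ltr_sqr2; first exact: dst_ge0.
have := ler_sqr2 (dst_ge0 z) zy; rewrite [X in _ <= X -> _]enorm_sqr.
have -> : dst y ^+ 2 = dot ((z - proj y) + (y - z)) ((z - proj y) + (y - z)).
  by rewrite -enorm_sqr [X in enorm X]addrC addrA subrK.
have sq : dot (y - z) (y - z) = h ^+ 2 by rewrite -enorm_sqr nyz.
have cr : dot (z - proj y) (y - z) = h * dst z - dot (proj y - proj z) (y - z).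
  have -> : z - proj y = (z - proj z) - (proj y - proj z) by rewrite opprB addrA subrK.
  rewrite dotDl dotNl; congr (_ - _).
  by rewrite yz dotZr -enorm_sqr -/(dst z) expr2 mulrA divfK // gt_eqF.
have := dot_le (proj y - proj z) (y - z); rewrite nyz.
have : enorm (proj y - proj z) * h < (1 - c) * dst z * h by rewrite ltr_pM2r.
have : (c * h) ^+ 2 < h ^+ 2.
  rewrite ltr_pXn2r ?nnegrE ?mulr_ge0 ?(ltW h0) //.
  by rewrite -[ltRHS]mul1r ltr_pM2r.
rewrite (dot_sqrD (z - proj y)) cr sq.
lra.
Qed.

(* By dst_ascent, a maximiser of dst - c |. - x0| with c < 1 lies on the sphere. *)
Lemma dst_ball_max x0 (s : R) : tube x0 -> 0 < dst x0 -> 0 <= s -> dst x0 + s < eps ->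
  exists2 z, enorm (z - x0) <= s & dst x0 + s <= dst z.
Proof.
move=> t0 d0 s0 se.
have tb y : enorm (y - x0) <= s -> tube y.
  by move=> ys; apply: (tube_near t0); lra.
have x00 : enorm (x0 - x0) <= s by rewrite subrr enorm0.
have [x y xs ys|z1 z1s z1P] := @lipschitz_ball_max _ _ dst 1 s x0 s0 ler01.
  by rewrite mul1r dst_lip //; apply: tb.
exists z1 => //; rewrite leNgt; apply/negP => lt.
have z10 := z1P x0 x00.
have sp : 0 < s by lra.
(* The slope [c] is midway between 1 and the largest mean slope reached in the ball, so that
   [dst z1 < dst x0 + c * s]. *)
set c := ((dst z1 - dst x0) / s + 1) / 2.
have tt : 0 <= (dst z1 - dst x0) / s < 1.
  by rewrite divr_ge0 ?subr_ge0 //= ltr_pdivrMr // mul1r; lra.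
have c01 : 0 <= c < 1 by rewrite /c; lra.
have cs : dst z1 < dst x0 + c * s.
  have -> : c * s = (dst z1 - dst x0 + s) / 2.
    by rewrite /c mulrAC mulrDl divfK ?gt_eqF // mul1r.
  lra.
have [|x y xs ys|z zs zP] :=
    @lipschitz_ball_max _ _ (fun y => dst y - c * enorm (y - x0)) 2 s x0 s0.
- by [].
- have := dst_lip (tb x xs) (tb y ys).
  have : c * enorm (y - x0) <= c * (enorm (x - y) + enorm (x - x0)).
    rewrite ler_wpM2l //; first by case/andP: c01.
    by rewrite (enormC x y) (enorm_dist x y x0).
  have : c * enorm (x - y) <= 1 * enorm (x - y).
    by rewrite ler_wpM2r ?enorm_ge0 //; case/andP: c01 => _ /ltW.
  lra.
have := zP _ x00; rewrite subrr enorm0 mulr0 subr0 => zx0.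
(* On the sphere, comparison with the centre would give dst z >= dst x0 + c s, above the maximum
   [dst z1]. In the interior, an ascent step contradicts maximality. *)
have [zs'|zs'] := ltP (enorm (z - x0)) s; last first.
  have E : enorm (z - x0) = s by apply/eqP; rewrite eq_le zs.
  by move: zx0; rewrite E; have := z1P z zs; move: cs; lra.
have dz : 0 < dst z.
  by have : 0 <= c * enorm (z - x0) by [rewrite mulr_ge0 ?enorm_ge0 //; case/andP: c01]; lra.
have se' : 0 < s - enorm (z - x0) by rewrite subr_gt0.
have [h /andP[h0 hs]] := dst_ascent (tb z zs) dz c01 se'.
set y := z + _ => dy.
have yz : enorm (y - z) = h.
  by rewrite /y addrC addKr enormZ gtr0_norm ?divr_gt0 // -/(dst z) divfK // gt_eqF.
have yx := enorm_dist z y x0; rewrite yz in yx.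
have := zP y; have -> : enorm (y - x0) <= s by lra.
move=> /(_ isT).
have : c * enorm (y - x0) <= c * (h + enorm (z - x0)).
  by rewrite ler_wpM2l //; case/andP: c01.
move: dy; lra.
Qed.

(* Federer's normal inequality: the ball of radius eps / 2 touching A at
   proj z from the side of z contains no point of A. *)
Lemma proj_normal z y : tube z -> A y ->
  dot (y - proj z) (z - proj z) <= enorm (y - proj z) ^+ 2 * dst z / eps.
Proof.
move=> tz Ay; set p := proj z.
have [d0|dp] := eqVneq (dst z) 0.
  rewrite d0 mulr0 mul0r; have := d0 => /enorm_eq0 ->.
  by rewrite -[0](scale0r y) dotZr mul0r.
have {dp} d0 : 0 < dst z by rewrite lt_neqAle eq_sym dp dst_ge0.
rewrite ler_pdivlMr //.
(* If [dst z] is at least [eps / 2], the empty ball around [z] itself suffices; otherwise [z] is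
   first pushed out to a point [z1] at distance at least [eps / 2] from [A]. *)
have [zbig|zsmall] := leP (eps / 2) (dst z).
  have : dst z ^+ 2 <= enorm (z - y) ^+ 2.
    by apply: ler_sqr2 (dst_ge0 z) _; apply: dst_le.
  have -> : z - y = (z - p) - (y - p) by rewrite opprB addrA subrK.
  rewrite /dst !enorm_sqr -/p (dot_sqrB (z - p) (y - p)) (dotC (z - p) (y - p)).
  move=> le; have le2 : dot (y - p) (z - p) <= enorm (y - p) ^+ 2 / 2.
    by rewrite enorm_sqr; lra.
  apply: (le_trans (ler_wpM2r (ltW eps_gt0) le2)).
  have : enorm (y - p) ^+ 2 * (eps / 2) <= enorm (y - p) ^+ 2 * dst z.
    by rewrite ler_wpM2l // sqr_ge0.
  by rewrite enorm_sqr /dst -/p; lra.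
have [| |z1 z1s z1d] := @dst_ball_max z (eps / 2 - dst z) tz d0; [lra|lra|].
have tz1 : tube z1 by apply: (tube_near tz); lra.
have Ap : A p by have [] := projP tz.
have vn : dst z * (eps / 2 - dst z) <= dot (z - p) (z1 - z).
  have : (eps / 2) ^+ 2 <= enorm (z1 - p) ^+ 2.
    by apply: ler_sqr2; [lra | apply: le_trans (dst_le tz1 Ap); lra].
  have -> : z1 - p = (z - p) + (z1 - z) by rewrite [RHS]addrC addrA subrK.
  rewrite enorm_sqr (dot_sqrD (z - p)).
  rewrite -!enorm_sqr -/(dst z).
  have : enorm (z1 - z) ^+ 2 <= (eps / 2 - dst z) ^+ 2.
    exact: ler_sqr2 (enorm_ge0 _) z1s.
  lra.
set r := eps / 2 / dst z.
have rd : r * dst z = eps / 2 by rewrite /r divfK // gt_eqF.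
(* The triangle inequality |z1 - p| <= |z1 - z| + |z - p| is forced to be an equality, so [z1] lies
   on the ray from [p] through [z]. The proof expands a square and bounds it by 0 with [vn]. *)
have z1E : z1 - p = r *: (z - p).
  suff /enorm_eq0/eqP : enorm (z1 - z - (r - 1) *: (z - p)) = 0.
    rewrite subr_eq0 => /eqP E.
    have -> : z1 - p = (z1 - z) + (z - p) by rewrite addrA subrK.
    by rewrite E scalerBl scale1r subrK.
  apply/eqP; rewrite eq_le enorm_ge0 andbT; apply: enorm_le => //.
  rewrite (dot_sqrB (z1 - z) (_ *: _)) dotZl !dotZr (dotC (z1 - z) (z - p)).
  rewrite -!enorm_sqr -/(dst z).
  have : enorm (z1 - z) ^+ 2 <= (eps / 2 - dst z) ^+ 2.
    exact: ler_sqr2 (enorm_ge0 _) z1s.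
  have r1 : 0 <= r - 1 by rewrite subr_ge0 /r ler_pdivlMr // mul1r ltW.
  have := ler_wpM2l r1 vn.
  have -> : (r - 1) * (dst z * (eps / 2 - dst z)) = (eps / 2 - dst z) ^+ 2.
    by rewrite mulrA mulrBl rd mul1r expr2.
  have -> : (r - 1) * ((r - 1) * dst z ^+ 2) = (eps / 2 - dst z) ^+ 2.
    by rewrite -rd; ring.
  lra.
have : (eps / 2) ^+ 2 <= enorm (z1 - y) ^+ 2.
  by apply: ler_sqr2; [lra | apply: le_trans (dst_le tz1 Ay); lra].
have -> : z1 - y = r *: (z - p) - (y - p) by rewrite -z1E opprB addrA subrK.
rewrite enorm_sqr (dot_sqrB (_ *: _)) !dotZl dotZr (dotC (z - p) (y - p)).
rewrite -!enorm_sqr -/(dst z).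
have -> : r * (r * dst z ^+ 2) = (eps / 2) ^+ 2 by rewrite -rd; ring.
move=> H; have H2 : 2 * (r * dot (y - p) (z - p)) <= enorm (y - p) ^+ 2 by lra.
have -> : dot (y - p) (z - p) * eps = 2 * (r * dot (y - p) (z - p)) * dst z.
  have : eps = 2 * (r * dst z) by rewrite rd; lra.
  by move=> ->; ring.
by rewrite ler_wpM2r // ltW.
Qed.

(** Average the normal inequalities of [x] and [y] at p = proj z with weights 1 - t and t. The left
    side becomes dst z ^ 2, and the weighted squares are t (1 - t) |y - x| ^ 2 + dst z ^ 2. After
    division by [dst z], the last square is absorbed because dst z <= eps / 2. *)
Lemma reach_segment x y (t : R) : A x -> A y -> enorm (y - x) <= eps / 2 -> 0 <= t <= 1 ->
  exists2 q, A q & enorm (q - (x + t *: (y - x))) <= 2 / eps * t * enorm (y - x) ^+ 2.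
Proof.
move=> Ax Ay xy /andP[t0 t1]; set z := x + _; set L := enorm (y - x).
rewrite -/L in xy; have zx : enorm (z - x) = t * L by rewrite /z addrC addKr enormZ ger0_norm.
have tL : t * L <= L by rewrite -[leRHS]mul1r ler_wpM2r ?enorm_ge0.
have tz : tube z by exists x; split => //; rewrite zx; move: eps_gt0; lra.
exists (proj z); first by have [] := projP tz.
rewrite enormC -/(dst z).
have [->|dp] := eqVneq (dst z) 0.
  by rewrite mulr_ge0 ?sqr_ge0 // mulr_ge0 // divr_ge0 // ltW.
have {dp} d0 : 0 < dst z by rewrite lt_neqAle eq_sym dp dst_ge0.
have dL : dst z <= eps / 2 by apply: le_trans (dst_le tz Ax) _; rewrite zx; lra.
have := ler_wpM2l t0 (proj_normal tz Ay).
have t1' : 0 <= 1 - t by rewrite subr_ge0.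
have := ler_wpM2l t1' (proj_normal tz Ax).
set p := proj z.
have D : dst z ^+ 2 = (1 - t) * dot (x - p) (z - p) + t * dot (y - p) (z - p).
  rewrite -!dotZl -dotDl /dst enorm_sqr -/p; congr dot.
  by rewrite /z; apply/rowP => i; rewrite !mxE; ring.
have S : (1 - t) * enorm (x - p) ^+ 2 + t * enorm (y - p) ^+ 2 =
    t * (1 - t) * L ^+ 2 + dst z ^+ 2.
  rewrite /L /dst -/p !enorm_sqr.
  have -> : z - p = (x - p) + t *: ((y - p) - (x - p)).
    by rewrite /z; apply/rowP => i; rewrite !mxE; ring.
  have -> : y - x = (y - p) - (x - p) by rewrite opprB addrA subrK.
  move: (x - p) (y - p) => a b; rewrite !dotE (dotC b a); ring.
move=> h1 h2.
have : dst z ^+ 2 <= (t * (1 - t) * L ^+ 2 + dst z ^+ 2) * dst z / eps.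
  rewrite -S D; apply: le_trans (lerD h1 h2) _.
  by rewrite le_eqVlt; apply/orP; left; apply/eqP; ring.
rewrite ler_pdivlMr // expr2 -(mulrA (dst z)) (mulrC (dst z)) ler_pM2r // => h3.
have : dst z * dst z <= eps / 2 * dst z by rewrite ler_wpM2r // ltW.
have : t * (1 - t) * L ^+ 2 <= t * L ^+ 2.
  rewrite -mulrA ler_wpM2l // -[leRHS]mul1r ler_wpM2r ?sqr_ge0 //; lra.
have -> : 2 / eps * t * L ^+ 2 = (2 * (t * L ^+ 2)) / eps by ring.
rewrite ler_pdivlMr //; move: h3; rewrite expr2; lra.
Qed.

(** The segment estimate at t = 1 / (m + 1), magnified by m + 1, keeps the vectors (m + 1) (q_m - x)
    within the stated distance of [y - x]; a cluster point of them is tangent. *)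
Lemma reach_Tan x y : A x -> A y -> enorm (y - x) <= eps / 2 ->
  exists2 w, Tan A x w & enorm (w - (y - x)) <= 2 / eps * enorm (y - x) ^+ 2.
Proof.
move=> Ax Ay xy; set L := enorm (y - x); set C := 2 / eps.
have C0 : 0 <= C by rewrite divr_ge0 // ltW.
have L0 : 0 <= L := enorm_ge0 _.
have /choice[q qP] (m : nat) : exists q, A q /\
    enorm (m.+1%:R *: (q - x) - (y - x)) <= C * L ^+ 2.
  have t01 : 0 <= (m.+1%:R^-1 : R) <= 1.
    by rewrite invr_ge0 ler0n /= invf_le1 // ler1n.
  have [q Aq qE] := reach_segment Ax Ay xy t01; exists q; split => //.
  have -> : m.+1%:R *: (q - x) - (y - x) = m.+1%:R *: (q - (x + m.+1%:R^-1 *: (y - x))).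
    by rewrite [in RHS]opprD addrA [RHS]scalerBr scalerA divff ?pnatr_eq0 // scale1r.
  rewrite enormZ ger0_norm ?ler0n //.
  apply: le_trans (ler_wpM2l (ler0n _ _) qE) _.
  by rewrite -/C -/L (mulrC C m.+1%:R^-1) -!mulrA mulVKf ?pnatr_eq0.
have [|w wP] := @bounded_cluster _ _ (fun m => m.+1%:R *: (q m - x)) (C * L ^+ 2 + L).
  move=> m; have [_ h] := qP m.
  rewrite -(subrK (y - x) (_ *: _)); apply: le_trans (enormD _ _) _.
  by rewrite lerD2r.
exists w; last first.
  apply/ler_addgt0Pr => e e0; have [m _ me] := wP e e0 0%N.
  have [_ h] := qP m.
  have := enorm_dist (m.+1%:R *: (q m - x)) w (y - x).
  rewrite (enormC w (_ *: _)); move: h; rewrite /=; lra.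
have [->|w0] := eqVneq w 0; [by left | right].
have nw := enorm_gt0 w0.
(* The bound by [enorm w] excludes q_i = x, whose magnified vector would be 0; the definition of
   [Tan] demands points distinct from [x]. *)
have /choice[s sP] (m : nat) : exists i, (m <= i)%N /\
    enorm (i.+1%:R *: (q i - x) - w) < Num.min m.+1%:R^-1 (enorm w).
  have [|i mi ie] := wP (Num.min m.+1%:R^-1 (enorm w)) _ m; last by exists i.
  by rewrite lt_min nw invr_gt0 ltr0Sn.
exists (fun m => q (s m)), (fun m => (s m).+1%:R); split=> [m|].
  split; first by case: (qP (s m)).
  split=> //; apply/eqP => E; have [_] := sP m.
  by rewrite E subrr scaler0 sub0r enormN lt_min ltxx andbF.
split=> e e0.
  have K0 : 0 < C * L ^+ 2 + L + 1.
    by rewrite ltr_wpDl // addr_ge0 // mulr_ge0 // sqr_ge0.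
  have [N NP] := @invS_lt R (e / (C * L ^+ 2 + L + 1)) (divr_gt0 e0 K0).
  exists N => m Nm; have [ms _] := sP m.
  have := NP (s m) (leq_trans Nm ms).
  rewrite ltr_pdivlMr // => h; apply: le_lt_trans h.
  have [_ h] := qP (s m).
  have -> : q (s m) - x = (s m).+1%:R^-1 *: ((s m).+1%:R *: (q (s m) - x)).
    by rewrite scalerA mulVf ?pnatr_eq0 // scale1r.
  rewrite enormZ.
  rewrite ger0_norm ?invr_ge0 ?ler0n // ler_wpM2l ?invr_ge0 ?ler0n //.
  rewrite -(subrK (y - x) (_ *: _)); apply: le_trans (enormD _ _) _.
  by rewrite -/L; lra.
have [N NP] := invS_lt e0; exists N => m Nm; have [_] := sP m.
by rewrite lt_min => /andP[h _]; apply: lt_trans h (NP m Nm).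
Qed.

(** One point [p] of [A] with rho (p - a) close to [u] serves every [x] near [a] and every small
    [s]: follow the segment from [x] to [p] up to the parameter [s * rho]. Thus [delta] and [s0] do
    not depend on [x]. *)
Lemma reach_Tan_points a u (eta : R) : A a -> Tan A a u -> 0 < eta ->
  exists delta s0 : R, [/\ 0 < delta, 0 < s0 &
    forall x, A x -> enorm (x - a) < delta -> forall s, 0 < s <= s0 ->
      exists2 q, A q & enorm (q - x - s *: u) <= eta * s].
Proof.
move=> Aa [->|[xs [r [xr [xsa ru]]]]] eta0.
  exists 1, 1; split => // x Ax _ s /andP[/ltW s0 _]; exists x => //.
  by rewrite subrr scaler0 subrr enorm0 mulr_ge0 // ltW.
set K := enorm u + eta; have K0 : 0 < K by rewrite ltr_wpDl ?enorm_ge0.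
have eta3 : 0 < eta / 3 by rewrite divr_gt0.
(* Three errors share [eta]: replacing [u] by rho (p - a), replacing [a] by [x], and the distance
   from the segment to [A]. As rho |p - x| <= K, this [L] makes the third at most s eta / 3. *)
set L := Num.min (eps / 2) (eta * eps / (6 * K)).
have L0 : 0 < L by rewrite lt_min !divr_gt0 ?mulr_gt0.
have [N1 N1P] := xsa (L / 2) ltac:(by rewrite divr_gt0).
have [N2 N2P] := ru _ eta3.
set m := maxn N1 N2.
have ma := N1P m (leq_maxl _ _); have mu := N2P m (leq_maxr _ _).
have [Ap [_ r0]] := xr m; rewrite /= in mu.
move: (xs m) (r m) Ap r0 ma mu => p rho Ap r0 pa pu.
exists (Num.min (L / 2) (eta / 3 / rho)), rho^-1; split.
- by rewrite lt_min !divr_gt0.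
- by rewrite invr_gt0.
move=> x Ax; rewrite lt_min => /andP[xa xr'] s /andP[s0 sr].
have px : enorm (p - x) < L.
  by have := enorm_dist a p x; rewrite (enormC a x); lra.
have t01 : 0 <= s * rho <= 1.
  rewrite mulr_ge0 ?(ltW s0) ?(ltW r0) //=.
  by rewrite -(mulVf (lt0r_neq0 r0)) ler_wpM2r // ltW.
have pxe : enorm (p - x) <= eps / 2.
  by apply: le_trans (ltW px) _; rewrite ge_min lexx.
have [q Aq qE] := reach_segment Ax Ap pxe t01; exists q => //.
have rx : rho * enorm (x - a) <= eta / 3.
  by move: xr'; rewrite ltr_pdivlMr // mulrC => /ltW.
have rpx : enorm (rho *: (p - x) - u) <= eta * (2 / 3).
  have -> : rho *: (p - x) - u = (rho *: (p - a) - u) - rho *: (x - a).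
    by apply/rowP => i; rewrite !mxE; ring.
  apply: le_trans (enormB _ _) _; rewrite enormZ (gtr0_norm r0); lra.
have rK : rho * enorm (p - x) <= K.
  have := enormD (rho *: (p - x) - u) u; rewrite subrK enormZ (gtr0_norm r0) /K; lra.
have -> : q - x - s *: u = (q - (x + (s * rho) *: (p - x))) + s *: (rho *: (p - x) - u).
  by apply/rowP => i; rewrite !mxE; ring.
apply: le_trans (enormD _ _) _; rewrite enormZ (gtr0_norm s0).
have h1 : s * enorm (rho *: (p - x) - u) <= s * (eta * (2 / 3)).
  by rewrite ler_wpM2l // ltW.
suff h2 : 2 / eps * (s * rho) * enorm (p - x) ^+ 2 <= s * (eta / 3) by lra.
have -> : 2 / eps * (s * rho) * enorm (p - x) ^+ 2 =
    s * (2 / eps * ((rho * enorm (p - x)) * enorm (p - x))) by ring.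
rewrite ler_wpM2l ?(ltW s0) //.
have h3 : rho * enorm (p - x) * enorm (p - x) <= K * (eta * eps / (6 * K)).
  apply: ler_pM => //; rewrite ?enorm_ge0 //.
    by rewrite mulr_ge0 ?enorm_ge0 // ltW.
  by apply: le_trans (ltW px) _; rewrite ge_min lexx orbT.
have e2 : 0 <= 2 / eps by rewrite divr_ge0 // ltW.
apply: le_trans (ler_wpM2l e2 h3) _.
rewrite le_eqVlt; apply/orP; left; apply/eqP.
by field; rewrite !gt_eqF.
Qed.

End Reach.

(** * Extension of C^{1,1} jets *)

Section Convex.
Variables (R : realType) (n : nat).
Implicit Types (f : 'rV[R]_n -> R) (x u v p : 'rV[R]_n).

Definition cvx f := forall (x y : 'rV[R]_n) (t : R), 0 <= t <= 1 ->
  f (x + t *: (y - x)) <= f x + t * (f y - f x).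

(** A form of C^{1,1} without derivatives: since [C] is the same at all points, the gradients [g]
    are Lipschitz in [x]. *)
Definition quadratic_taylor f (C : R) := forall x, exists g, forall u,
  `|f (x + u) - f x - dot g u| <= C * enorm u ^+ 2.

(** * Differentiability of convex functions with second differences bounded above *)

Section Gradient.
Variables (H : 'rV[R]_n -> R) (c : R) (x : 'rV[R]_n).
Hypothesis cvxH : cvx H.
Hypothesis c_ge0 : 0 <= c.
Hypothesis semiconcaveH :
  forall h, H (x + h) + H (x - h) <= 2 * H x + c * enorm h ^+ 2.

Let q u (t : R) := (H (x + t *: u) - H x) / t.

Let q_nd u (s t : R) : 0 < s -> s <= t -> q u s <= q u t.
Proof.
move=> s0 st; have t0 : 0 < t := lt_le_trans s0 st.
have := cvxH x (x + t *: u) (t := s / t).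
rewrite divr_ge0 ?(ltW s0) ?(ltW t0) //= ler_pdivrMr // mul1r => /(_ st).
rewrite [x + t *: u - x]addrC addKr scalerA divfK ?gt_eqF // => h.
rewrite /q ler_pdivrMr // (mulrAC _ t^-1 s) -mulrA mulrC; lra.
Qed.

Let q_opp u (t : R) : 0 < t -> - q (- u) t <= q u t.
Proof.
move=> t0; have := cvxH (x - t *: u) (x + t *: u) (t := 1 / 2).
have -> : 0 <= (1 / 2 : R) <= 1 by lra.
have -> : x - t *: u + (1 / 2) *: (x + t *: u - (x - t *: u)) = x.
  by apply/rowP => i; rewrite !mxE; field.
move=> /(_ isT) h; rewrite /q scalerN -mulNr ler_pM2r ?invr_gt0 //; lra.
Qed.

Let q_opp_le u (t : R) : 0 < t -> q u t + q (- u) t <= c * t * enorm u ^+ 2.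
Proof.
move=> t0; have := semiconcaveH (t *: u).
rewrite enormZ (gtr0_norm t0) => h.
rewrite /q scalerN -mulrDl ler_pdivrMr //; lra.
Qed.

Let S u := [set q u t | t in [set t : R | 0 < t]].
(** The quotients are nondecreasing in [t], so this is the one-sided directional derivative at
    [x]. *)
Let D u := inf (S u).

Let S_lb u : has_lbound (S u).
Proof.
exists (- q (- u) 1) => _ [t /= t0 <-].
have [t1|t1] := leP t 1.
  by apply: le_trans (q_opp u t0); rewrite lerN2 q_nd.
by apply: le_trans (q_opp u ltr01) _; apply: q_nd => //; apply: ltW.
Qed.

Let S_neq0 u : S u !=set0. Proof. by exists (q u 1), 1 => /=. Qed.

Let D_le u (t : R) : 0 < t -> D u <= q u t.
Proof. by move=> t0; apply: ge_inf => //; exists t. Qed.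

Let D_approx u (e : R) : 0 < e -> exists2 t0 : R, 0 < t0 &
  forall t, 0 < t -> t <= t0 -> q u t < D u + e.
Proof.
move=> e0; have [|_ [t0 /= t00 <-] h] := @inf_adherent _ (S u) e e0.
  by split.
by exists t0 => // t tp tt; apply: le_lt_trans h; apply: q_nd.
Qed.

Let D0 : D 0 = 0.
Proof.
have S0 t : q 0 t = 0 by rewrite /q scaler0 addr0 subrr mul0r.
apply/eqP; rewrite eq_le -{1}(S0 1) D_le //=.
by apply: lb_le_inf => // _ [t _ <-]; rewrite S0.
Qed.

Let D_sub u v : D (u + v) <= D u + D v.
Proof.
apply/ler_addgt0Pr => e e0; have e2 : 0 < e / 2 by rewrite divr_gt0.
have [s s0 sP] := D_approx u e2; have [t t0 tP] := D_approx v e2.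
set r := Num.min s t; have r0 : 0 < r by rewrite lt_min s0.
have rs : r <= s by rewrite ge_min lexx.
have rt : r <= t by rewrite ge_min lexx orbT.
clearbody r.
have r2 : 0 < r / 2 by rewrite divr_gt0.
have := sP r r0 rs; have := tP r r0 rt; have := D_le (u + v) r2.
have : q (u + v) (r / 2) <= q u r + q v r.
  have := cvxH (x + r *: u) (x + r *: v) (t := 1 / 2).
  have -> : 0 <= (1 / 2 : R) <= 1 by lra.
  have -> : x + r *: u + (1 / 2) *: (x + r *: v - (x + r *: u)) =
      x + (r / 2) *: (u + v).
    by apply/rowP => i; rewrite !mxE; field.
  move=> /(_ isT) h; rewrite /q -mulrDl invfM invrK mulrA mulrAC ler_pM2r ?invr_gt0 //.
  lra.
lra.
Qed.

(** Convexity alone makes [D] sublinear. The bound on second differences gives D u + D (-u) <= c t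
    |u| ^ 2 for all t > 0, which makes it linear. *)
Let D_opp u : D (- u) = - D u.
Proof.
have h1 := D_sub u (- u); rewrite subrr D0 in h1.
suff h2 : D u + D (- u) <= 0 by lra.
apply/ler_addgt0Pr => e e0; rewrite add0r.
have K0 : 0 < c * enorm u ^+ 2 + 1 by rewrite ltr_wpDl // mulr_ge0 ?sqr_ge0.
set t := e / (c * enorm u ^+ 2 + 1); have t0 : 0 < t by rewrite divr_gt0.
apply: le_trans (lerD (D_le u t0) (D_le (- u) t0)) _.
apply: le_trans (q_opp_le u t0) _.
have tE : t * (c * enorm u ^+ 2 + 1) = e by rewrite /t divfK // gt_eqF.
clearbody t; lra.
Qed.

Let DD u v : D (u + v) = D u + D v.
Proof.
have h1 := D_sub u v; have h2 := D_sub (u + v) (- v).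
rewrite addrK D_opp in h2; lra.
Qed.

Let DZ_le (k : R) u : 0 < k -> D (k *: u) <= k * D u.
Proof.
move=> k0; rewrite -ler_pdivrMl //; apply: lb_le_inf => // _ [t /= t0 <-].
rewrite ler_pdivrMl //; apply: le_trans (D_le _ (divr_gt0 t0 k0)) _.
by rewrite /q scalerA divfK ?gt_eqF // invf_div mulrCA.
Qed.

Let DZ (k : R) u : D (k *: u) = k * D u.
Proof.
have DZp (r : R) v : 0 < r -> D (r *: v) = r * D v.
  move=> r0; apply/eqP; rewrite eq_le DZ_le //=.
  have := @DZ_le r^-1 (r *: v); rewrite invr_gt0 r0 => /(_ isT).
  by rewrite scalerA mulVf ?gt_eqF // scale1r -ler_pdivrMl ?invr_gt0 // invrK.
have [k0|k0|->] := ltgtP k 0; [|exact: DZp|by rewrite scale0r mul0r D0].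
by rewrite -[k]opprK scaleNr D_opp DZp ?oppr_gt0 // !mulNr.
Qed.

(** Since [D] is linear, it is the product with a vector. Convexity puts H above its tangent at both
    x + u and x - u, and the second difference bounds the sum of the two excesses. *)
Lemma cvx_gradient : exists g, forall u,
  `|H (x + u) - H x - dot g u| <= c * enorm u ^+ 2.
Proof.
pose g : 'rV[R]_n := \row_i D (delta_mx ord0 i).
exists g => u; have -> : dot g u = D u.
  rewrite [in RHS](row_sum_delta u) (big_morph D DD D0).
  by apply: eq_bigr => i _; rewrite DZ mxE mulrC.
have h1 := D_le u ltr01; have h2 := D_le (- u) ltr01.
rewrite D_opp in h2; move: h1 h2; rewrite /q !scale1r !divr1 => h1 h2.
by have := semiconcaveH u; rewrite ler_norml; lra.
Qed.

End Gradient.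

(** Compatibility of the jets says that every lower paraboloid [L y] is below every upper one [U z].
    Hence L i <= H <= U i, and both ends equal f i + m |e i| ^ 2 at [e i]. *)
Lemma quadratic_jet_extension (I : Type) (P : set I) (e g : I -> 'rV[R]_n)
    (f : I -> R) (K : R) : P !=set0 -> 0 <= K ->
  (forall y z, P y -> P z ->
     `|f y - f z - dot (g z) (e y - e z)| <= K * enorm (e y - e z) ^+ 2) ->
  (forall y z, P y -> P z -> enorm (g y - g z) <= K * enorm (e y - e z)) ->
  exists F (C : R), [/\ 0 <= C, quadratic_taylor F C & forall i, P i -> F (e i) = f i].
Proof.
(* The errors in comparing [L y] with [U z] total at most (7/2) K (|p - e y| ^ 2 + |p - e z| ^ 2),
   which [m] absorbs. *)
move=> [i0 Pi0] K0 fP gP; pose m := 4 * K.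
have m0 : 0 <= m by rewrite mulr_ge0.
pose U z p := f z + dot (g z) (p - e z) + m * dot (p - e z) (p - e z) + m * dot p p.
pose L y p := f y + dot (g y) (p - e y) - m * dot (p - e y) (p - e y) + m * dot p p.
pose Fam : set ('rV[R]_n -> R) :=
  [set h | cvx h /\ forall z, P z -> forall p, h p <= U z p].
have LU y z p : P y -> P z -> L y p <= U z p.
  move=> Py Pz; rewrite /L /U lerD2r.
  have := fP y z Py Pz; have := gP y z Py Pz.
  have -> : e y - e z = (p - e z) - (p - e y) by rewrite opprB [RHS]addrC addrA subrK.
  move: (p - e z) (p - e y) => a b; set Dl := enorm (a - b) => gb.
  rewrite ler_norml => /andP[_ fb].
  have d1 : dot (g y - g z) b <= K * (Dl * enorm b).
    rewrite mulrA; apply: le_trans (dot_le _ _) _.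
    by rewrite ler_wpM2r ?enorm_ge0.
  have d2 : Dl ^+ 2 <= 2 * dot a a + 2 * dot b b.
    have := dot_ge0 (a + b); rewrite dot_sqrD /Dl enorm_sqr dot_sqrB; lra.
  have d3 : Dl * enorm b <= (Dl ^+ 2 + dot b b) / 2.
    rewrite -enorm_sqr; have := sqr_ge0 (Dl - enorm b); lra.
  have d4 := ler_wpM2l K0 d2; have d5 := ler_wpM2l K0 d3.
  have b0 := mulr_ge0 K0 (dot_ge0 b); have a0 := mulr_ge0 K0 (dot_ge0 a).
  move: fb d1; rewrite !(dotDr _ _ (g z)) !dotDl !dotNl !dotNr /m; lra.
(* The summand m |p| ^ 2 cancels the concave quadratic part: [L y] is affine, hence convex and a
   member of [Fam]. *)
have LE y p : L y p = f y - dot (g y) (e y) - m * dot (e y) (e y) +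
    dot (g y + (2 * m) *: e y) p.
  by rewrite /L dot_sqrB !dotE (dotC p (e y)); ring.
have FamL y : P y -> Fam (L y).
  move=> Py; split=> [x z t _|z Pz p]; last exact: LU.
  by rewrite !LE; move: (g y + _) => w; rewrite !dotDr !dotZr !dotDr !dotNr; lra.
pose T p := [set h p | h in Fam].
have Tne p : T p !=set0 by exists (L i0 p), (L i0) => //; exact: FamL.
have Tub p : has_ubound (T p).
  by exists (U i0 p) => _ [h [_ hU] <-]; apply: hU.
pose H p := sup (T p).
have FamH h p : Fam h -> h p <= H p.
  by move=> Fh; apply: ub_le_sup => //; exists h.
have HU z p : P z -> H p <= U z p.
  by move=> Pz; apply: ge_sup => // _ [h [_ hU] <-]; apply: hU.
have cvxH : cvx H.
  move=> x y t t01; apply: ge_sup => // _ [h Fh <-].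
  have [ch _] := Fh; apply: le_trans (ch x y t t01) _.
  have /andP[t0 t1] := t01; have t1' : 0 <= 1 - t by lra.
  have := ler_wpM2l t0 (FamH h y Fh); have := ler_wpM2l t1' (FamH h x Fh); lra.
(* Averaging [U z] over p + h and p - h raises it by exactly 2 m |h| ^ 2, so the averaged H minus
   this amount competes in the supremum. *)
have scH x h : H (x + h) + H (x - h) <= 2 * H x + 4 * m * enorm h ^+ 2.
  suff /(FamH _ x) : Fam (fun p => (H (p + h) + H (p - h)) / 2 - 2 * m * dot h h).
    by rewrite enorm_sqr; lra.
  split=> [y z t t01|z Pz p].
    have := cvxH (y + h) (z + h) t t01; have := cvxH (y - h) (z - h) t t01.
    have -> : y - h + t *: (z - h - (y - h)) = y + t *: (z - y) - h.
      by apply/rowP => i; rewrite !mxE; ring.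
    have -> : y + h + t *: (z + h - (y + h)) = y + t *: (z - y) + h.
      by apply/rowP => i; rewrite !mxE; ring.
    lra.
  have := HU z (p + h) Pz; have := HU z (p - h) Pz; rewrite /U.
  have -> : p + h - e z = (p - e z) + h by rewrite addrAC.
  have -> : p - h - e z = (p - e z) - h by rewrite addrAC.
  rewrite !(dot_sqrB _ h) !(dot_sqrD _ h) !(dotDr _ h (g z)) !(dotDr _ (- h) (g z)).
  rewrite (dotNr h (g z)); lra.
exists (fun p => H p - m * dot p p), (4 * m + m); split.
- by rewrite addr_ge0 // mulr_ge0.
- move=> x; have m4 : 0 <= 4 * m by rewrite mulr_ge0.
  have [G GP] := @cvx_gradient H (4 * m) x cvxH m4 (scH x).
  exists (G - (2 * m) *: x) => u; have := GP u.
  have := mulr_ge0 m0 (dot_ge0 u).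
  rewrite !ler_norml !enorm_sqr dot_sqrD dotDl dotNl dotZl; lra.
- move=> i Pi; have := HU i (e i) Pi; have := FamH _ (e i) (FamL i Pi).
  have z0 (a : 'rV[R]_n) : dot a 0 = 0 by rewrite -[0](scale0r a) dotZr mul0r.
  by rewrite /U /L subrr !z0; lra.
Qed.

End Convex.

(** * From scalar Taylor estimates to C^{1,1} maps between Euclidean spaces *)

Lemma mulmx_bounded (R : realType) m n (N : 'M[R]_(m, n)) :
  exists2 C : R, 0 <= C & forall z : 'rV_m, enorm (z *m N) <= C * enorm z.
Proof.
exists (\sum_i enorm (row i N)) => [|z]; first by apply: sumr_ge0 => i _; apply: enorm_ge0.
rewrite mulmx_sum_row mulr_suml.
elim/big_ind2 : _ => [|a b u v ha hb|i _]; first by rewrite enorm0.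
  exact: le_trans (enormD _ _) (lerD ha hb).
by rewrite enormZ mulrC ler_wpM2l ?enorm_ge0 // coord_le_enorm.
Qed.

(** Expand f (v + h') from [v] and from [w], and f v from [w]. If |h'| = |v - w|, the remainders add
    up to (1 + 4 + 1) C |v - w| ^ 2 and bound h' (J v - J w); linearity in the direction then
    reaches every [h]. *)
Lemma C11_of_taylor (R : realType) k d (f : 'rV[R]_k -> 'rV[R]_d)
    (J : 'rV[R]_k -> 'M[R]_(k, d)) (C : R) : 0 <= C ->
  (forall x u, enorm (f (x + u) - f x - u *m J x) <= C * enorm u ^+ 2) ->
  C11 f.
Proof.
move=> C0 fJ.
pose df x : {linear 'rV[R]_k -> 'rV[R]_d} := mulmxr (J x).
have cont x : continuous (df x).
  apply/linear_bounded_continuous.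
  apply/linear_boundedP; have [B B0 BP] := mulmx_bounded (J x).
  near=> r => z /=; apply: le_trans (norm_le_enorm _) _.
  apply: le_trans (BP z) _; apply: le_trans (ler_wpM2l B0 (enorm_le_norm z)) _.
  rewrite mulrA ler_wpM2r //; near: r; apply: nbhs_pinfty_ge; exact: num_real.
have loc x : f \o shift x = cst (f x) + df x +o_ (0 : 'rV[R]_k) id.
  (* The little-o is measured in the sup norm; [k ^ 2] is the price of bounding the squared
     Euclidean norm by it. *)
  apply/eqaddoP => e e0; set B := C * k%:R ^+ 2 + 1.
  have B0 : 0 < B by rewrite ltr_wpDl // mulr_ge0 // sqr_ge0.
  have : \forall u \near (0 : 'rV[R]_k), `|u| <= e / B.
    exact: nbhs0_le (divr_gt0 e0 B0).
  apply: filterS => u ue /=.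
  have -> : (f \o shift x - (cst (f x) + df x)) u = f (x + u) - f x - u *m J x.
    by rewrite !fctE /= (addrC u x) opprD addrA.
  apply: le_trans (norm_le_enorm _) _; apply: le_trans (fJ _ _) _.
  have h1 := ler_sqr2 (enorm_ge0 u) (enorm_le_norm u).
  apply: le_trans (ler_wpM2l C0 h1) _.
  rewrite exprMn mulrA expr2 mulrA ler_wpM2r //.
  rewrite ler_pdivlMr // in ue; apply: le_trans ue.
  by rewrite mulrC ler_wpM2l // /B lerDl.
have dE x : 'd f x = df x :> (_ -> _) by apply: diff_unique.
have dfE x h : 'd f x h = h *m J x by rewrite (dE x).
split=> [x|]; first by apply/diff_locallyP; rewrite dE.
exists (6 * C) => v w h.
have -> : 'd f v h - 'd f w h = h *m (J v - J w).
  rewrite mulmxBr.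
  by congr (_ - _).
have [->|h0] := eqVneq h 0; first by rewrite mul0mx !enorm0 mulr0.
have [->|vw] := eqVneq v w; first by rewrite !subrr mulmx0 !enorm0 mulr0 mul0r.
have nh := enorm_gt0 h0; have nvw : 0 < enorm (v - w) by rewrite enorm_gt0 // subr_eq0.
set r := enorm (v - w) / enorm h; have r0 : 0 < r by rewrite divr_gt0.
pose h' := r *: h; have nh' : enorm h' = enorm (v - w).
  by rewrite enormZ (gtr0_norm r0) divfK // gt_eqF.
have key : enorm (h' *m (J v - J w)) <= 6 * C * enorm (v - w) ^+ 2.
  have t1 := fJ v h'; have t2 := fJ w (v - w); have t3 := fJ w (v - w + h').
  rewrite [w + _]addrC subrK in t2; rewrite addrA [w + _]addrC subrK in t3.
  rewrite nh' in t1.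
  have t4 : enorm (v - w + h') ^+ 2 <= 4 * enorm (v - w) ^+ 2.
    have -> : 4 * enorm (v - w) ^+ 2 = (enorm (v - w) + enorm (v - w)) ^+ 2 by ring.
    by apply: ler_sqr2 (enorm_ge0 _) _; rewrite -{2}nh' enormD.
  have -> : h' *m (J v - J w) = (f (v + h') - f w - (v - w + h') *m J w)
      - (f (v + h') - f v - h' *m J v) - (f v - f w - (v - w) *m J w).
    rewrite mulmxBr mulmxDl; apply/rowP => i; rewrite !mxE; ring.
  have := enormB (f (v + h') - f w - (v - w + h') *m J w
      - (f (v + h') - f v - h' *m J v)) (f v - f w - (v - w) *m J w).
  have := enormB (f (v + h') - f w - (v - w + h') *m J w)
      (f (v + h') - f v - h' *m J v).
  have := ler_wpM2l C0 t4; lra.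
move: key; rewrite -scalemxAl enormZ (gtr0_norm r0) -ler_pdivlMl //.
move=> h1; apply: le_trans h1 _; rewrite le_eqVlt; apply/orP; left; apply/eqP.
by rewrite /r; field; rewrite !gt_eqF.
Unshelve. all: by end_near. Qed.

(** Each coordinate is a scalar jet whose gradients are the columns of [G]. The factor [N] leaves
    room for a later projection onto the orthogonal complement of W. *)
Lemma C11_jet_extension (R : realType) k d (I : Type) (P : set I)
    (e : I -> 'rV[R]_k) (f : I -> 'rV[R]_d) (G : I -> 'M[R]_(k, d))
    (N : 'M[R]_d) (K : R) : P !=set0 -> 0 <= K ->
  (forall y z, P y -> P z ->
     enorm (f y - f z - (e y - e z) *m G z) <= K * enorm (e y - e z) ^+ 2) ->
  (forall y z u, P y -> P z ->
     enorm (u *m (G y - G z)) <= K * enorm (e y - e z) * enorm u) ->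
  exists2 F : 'rV[R]_k -> 'rV[R]_d, C11 (fun v => F v *m N) &
    forall i, P i -> F (e i) = f i.
Proof.
move=> P0 K0 fP GP.
have dotcol (M : 'M[R]_(k, d)) j u : dot (col j M)^T u = (u *m M) ord0 j.
  by rewrite mxE; apply: eq_bigr => i _; rewrite !mxE mulrC.
have ext j : exists Fj : ('rV[R]_k -> R) * R, [/\ 0 <= Fj.2, quadratic_taylor Fj.1 Fj.2 &
    forall i, P i -> Fj.1 (e i) = f i ord0 j].
  have [y z Py Pz|y z Py Pz|F [C [C0 FC FE]]] := @quadratic_jet_extension R k I P e
      (fun i => (col j (G i))^T) (fun i => f i ord0 j) K P0 K0.
  - rewrite dotcol; apply: le_trans (fP y z Py Pz).
    by apply: le_trans (coord_le_enorm _ j); rewrite !mxE.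
  - have [->|g0] := eqVneq ((col j (G y))^T - (col j (G z))^T) 0.
      by rewrite enorm0 mulr_ge0 // enorm_ge0.
    (* The operator bound is tested on the difference [u] of the two columns itself, giving |u| ^ 2
       <= K |e y - e z| |u|. *)
    rewrite -(ler_pM2r (enorm_gt0 g0)) -expr2 enorm_sqr.
    set u := _ - _; apply: le_trans (GP y z u Py Pz).
    apply: le_trans (ler_norm _) _; apply: le_trans (coord_le_enorm _ j).
    rewrite -dotcol; suff -> : (col j (G y - G z))^T = u by [].
    by apply/rowP => i; rewrite !mxE.
  - by exists (F, C).
have [Fj FjP] := choice ext.
have [J JP] : exists J : 'I_d -> 'rV[R]_k -> 'rV[R]_k, forall j x u,
    `|(Fj j).1 (x + u) - (Fj j).1 x - dot (J j x) u| <= (Fj j).2 * enorm u ^+ 2.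
  have /choice[J JP] : forall jx : 'I_d * 'rV[R]_k, exists g, forall u,
     `|(Fj jx.1).1 (jx.2 + u) - (Fj jx.1).1 jx.2 - dot g u| <= (Fj jx.1).2 * enorm u ^+ 2.
    by move=> [j x]; have [_ /(_ x)] := FjP j.
  by exists (fun j x => J (j, x)) => j x u; exact: (JP (j, x)).
pose F x : 'rV[R]_d := \row_j (Fj j).1 x.
pose M x : 'M[R]_(k, d) := \matrix_(i, j) J j x ord0 i.
have [B B0 BP] := mulmx_bounded N.
have S0 : 0 <= \sum_j (Fj j).2 by apply: sumr_ge0 => j _; have [] := FjP j.
exists F => [|i Pi]; last by apply/rowP => j; rewrite mxE; have [_ _ ->] := FjP j.
apply: (@C11_of_taylor _ _ _ _ (fun x => M x *m N) (B * \sum_j (Fj j).2)).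
  by rewrite mulr_ge0.
move=> x u; rewrite mulmxA -!mulmxBl -mulrA; apply: le_trans (BP _) _.
rewrite ler_wpM2l //; apply: le_trans (enorm_le_sum _) _; rewrite mulr_suml.
apply: ler_sum => j _; apply: le_trans (JP j x u); rewrite !mxE.
suff -> : \sum_i u ord0 i * M x i j = dot (J j x) u by [].
by apply: eq_bigr => i _; rewrite mxE mulrC.
Qed.

(** * The jet of T_k *)

(** A maximal independent family of vectors of S spans a space containing S; minimality of [M]
    forces its size to be [k]. *)
Lemma span_dim_basis (R : realType) d (S : set 'rV[R]_d) k : span_dim S k ->
  exists2 U : 'M[R]_(k, d), row_free U & forall i, S (row i U).
Proof.
move=> [M [freeM SM minM]].
pose Q r := `[< exists2 U : 'M[R]_(r, d), row_free U & forall i, S (row i U) >].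
have Q0 : exists r, Q r.
  exists 0%N; apply/asboolP; exists 0; last by case.
  by rewrite /row_free mxrank0.
have Qd r : Q r -> (r <= d)%N.
  by move=> /asboolP[U /eqP rU _]; rewrite -rU rank_leq_col.
have [r /asboolP[U freeU SU] maxr] := ex_maxnP Q0 Qd.
have SUsub u : S u -> (u <= U)%MS.
  move=> Su; apply: contrapT => /negP uU.
  have : (r < r.+1)%N by [].
  rewrite ltnNge maxr //; apply/asboolP; exists (col_mx u U : 'M[R]_(1 + r, d)).
    rewrite /row_free eqn_leq rank_leq_row /=.
    have : (U < col_mx u U)%MS.
      rewrite ltmxE col_mx_sub (negbTE uU) /= andbT.
      by have := submx_refl (col_mx u U); rewrite col_mx_sub => /andP[].
    by move/rank_ltmx; rewrite (eqP freeU).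
  move=> i; case: (@split_ordP 1 r i) => j ->; last by rewrite [row _ _](@rowKd _ 1 r _ j u U).
  by rewrite [row _ _](@rowKu _ 1 r _ j u U) row_id.
have /mxrankS := minM r U SUsub; rewrite (eqP freeM) (eqP freeU) => kr.
have : (U <= M)%MS by apply/row_subP => i; apply: SM.
move/mxrankS; rewrite (eqP freeM) (eqP freeU) => rk.
have rkE : r = k by apply/eqP; rewrite eqn_leq rk kr.
by subst r; exists U.
Qed.

(** A matrix of rank [k] has [k] independent columns, and [B] selects them. W is thus a coordinate
    plane, in general not the tangent span, with standard basis vectors as orthonormal basis. *)
Lemma coordinate_projection (R : realType) k d (U : 'M[R]_(k, d)) : row_free U ->
  exists2 B : 'M[R]_(k, d), B *m B^T = 1%:M & U *m B^T \in unitmx.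
Proof.
move=> freeU; have fullU : row_full U^T by rewrite /row_full mxrank_tr.
pose g := fullrankfun fullU.
exists (rowsub g 1%:M).
  apply/matrixP => i j; rewrite mul_rowsub_mx mul1mx !mxE.
  by rewrite (inj_eq (@fullrankfun_inj _ _ _ _ fullU)) eq_sym.
rewrite -unitmx_tr trmx_mul trmxK mul_rowsub_mx mul1mx.
exact: fullrowsub_unit.
Qed.

Lemma mulmx_rows_le (R : realType) k d (Q : 'M[R]_(k, d)) (e : R) :
  (forall i, enorm (row i Q) <= e) ->
  forall z, enorm (z *m Q) <= k%:R * e * enorm z.
Proof.
move=> Qe z; rewrite mulmx_sum_row.
have -> : k%:R * e * enorm z = \sum_(i < k) (enorm z * e).
  by rewrite sumr_const card_ord -mulr_natl; ring.
elim/big_ind2 : _ => [|a b u v ha hb|i _]; first by rewrite enorm0.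
  exact: le_trans (enormD _ _) (lerD ha hb).
by rewrite enormZ ler_pM ?enorm_ge0 // coord_le_enorm.
Qed.

Lemma near_identity_inv (R : realType) k (X : 'M[R]_k) :
  (forall z, enorm (z *m X - z) <= enorm z / 2) ->
  X \in unitmx /\ forall u : 'rV_k, enorm (u *m invmx X) <= 2 * enorm u.
Proof.
move=> XP.
have Xinv (z : 'rV_k) : enorm z <= 2 * enorm (z *m X).
  have := XP z; have := enormB (z *m X) (z *m X - z).
  by rewrite opprB addrC subrK; lra.
have unitX : X \in unitmx.
  rewrite -row_free_unit -kermx_eq0; apply/eqP/row_matrixP => i.
  rewrite row0; apply: enorm_eq0; apply/eqP; rewrite eq_le enorm_ge0 andbT.
  by apply: le_trans (Xinv _) _; rewrite -row_mul mulmx_ker row0 enorm0 mulr0.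
by split=> // u; apply: le_trans (Xinv _) _; rewrite mulmxKV.
Qed.

(** * Frames of points of A, charts of the tangent spans and their Lipschitz dependence on the base
    point *)

Section Jets.
Variables (R : realType) (d k : nat) (A : set 'rV[R]_d) (eps C : R) (a : 'rV[R]_d).
Variables (U B : 'M[R]_(k, d)).
Hypothesis eps_gt0 : 0 < eps.
Hypothesis C_ge0 : 0 <= C.
Hypothesis Tan_approx : forall x y, A x -> A y -> enorm (y - x) <= eps / 2 ->
  exists2 w, Tan A x w & enorm (w - (y - x)) <= C * enorm (y - x) ^+ 2.
Hypothesis points_approx : forall u (eta : R), Tan A a u -> 0 < eta ->
  exists delta s0 : R, [/\ 0 < delta, 0 < s0 &
    forall x, A x -> enorm (x - a) < delta -> forall s, 0 < s <= s0 ->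
      exists2 q, A q & enorm (q - x - s *: u) <= eta * s].
Hypothesis TanU : forall i, Tan A a (row i U).
Hypothesis unitUB : U *m B^T \in unitmx.

(** [N *m U] is the basis of the span at [a] that projects to the standard basis of R^k. *)
Let N := invmx (U *m B^T).

Lemma frames (eta : R) : 0 < eta ->
  exists delta s0 : R, [/\ 0 < delta, 0 < s0 &
    forall x, A x -> enorm (x - a) < delta -> forall s, 0 < s <= s0 ->
      exists2 Q : 'M[R]_(k, d), forall i, A (x + row i Q) &
        forall i, enorm (row i (Q - s *: U)) <= eta * s].
Proof.
move=> eta0.
have /choice[p pP] (i : 'I_k) : exists p : R * R, [/\ 0 < p.1, 0 < p.2 &
    forall x, A x -> enorm (x - a) < p.1 -> forall s, 0 < s <= p.2 ->
      exists2 q, A q & enorm (q - x - s *: row i U) <= eta * s].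
  by have [de [s0 h]] := points_approx (TanU i) eta0; exists (de, s0).
exists (\big[Order.min/1]_i (p i).1), (\big[Order.min/1]_i (p i).2); split.
- by apply: lt_bigmin => // i _; have [] := pP i.
- by apply: lt_bigmin => // i _; have [] := pP i.
move=> x Ax xa s /andP[s0 ss].
have /choice[q qP] (i : 'I_k) : exists q, A q /\ enorm (q - x - s *: row i U) <= eta * s.
  have [_ _ h] := pP i.
  have [||q Aq qe] := h x Ax _ s; last by exists q.
    by apply: lt_le_trans xa _; apply: bigmin_le.
  by rewrite s0 (le_trans ss) //; apply: bigmin_le.
exists (\matrix_i (q i - x)) => i.
  by rewrite rowK addrC subrK; have [] := qP i.
by rewrite linearB linearZ /= rowK; have [] := qP i.
Qed.

(** Since N U B^T = 1, a frame [Q] close to [s *: U] has N Q B^T close to [s] times the identity.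
    The rows of [Q] lead from [x] to points of [A], so they can be examined from any other point of
    [A] as well. *)
Lemma adapted_frames : exists delta s0 L c : R,
  [/\ 0 < delta, 0 < s0, 0 <= L, 0 <= c &
    forall x, A x -> enorm (x - a) < delta -> forall s, 0 < s <= s0 ->
    exists Q : 'M[R]_(k, d), [/\ forall i, A (x + row i Q),
      forall i, enorm (row i Q) <= L * s,
      forall z, enorm (z *m (N *m Q) *m B^T - s *: z) <= s / 4 * enorm z &
      forall z, enorm (z *m (N *m Q)) <= c * s * enorm z]].
Proof.
have [c0 c00 c0P] := mulmx_bounded N; have [b b0 bP] := mulmx_bounded B^T.
set D := 4 * (k%:R * c0 * b + 1).
have kcb0 : 0 <= k%:R * c0 * b by rewrite !mulr_ge0.
have D0 : 0 < D by rewrite mulr_gt0 // ltr_wpDl.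
have eta0 : 0 < D^-1 by rewrite invr_gt0.
have etaP : k%:R * c0 * b * D^-1 <= 1 / 4.
  by rewrite ler_pdivrMr // /D; lra.
move: (D^-1) eta0 etaP => eta eta0 etaP.
have [delta [s0 [delta0 s00 h]]] := frames eta0.
set L := \sum_i enorm (row i U) + eta.
have L0 : 0 <= L.
  by rewrite addr_ge0 ?(ltW eta0) // sumr_ge0 // => i _; apply: enorm_ge0.
exists delta, s0, L, (k%:R * L * c0); split => //; first by rewrite !mulr_ge0.
move=> x Ax xa s ss; have [Q AQ QU] := h x Ax xa s ss; exists Q.
have /andP[sp _] := ss.
have QL i : enorm (row i Q) <= L * s.
  have UL : enorm (row i U) <= \sum_i enorm (row i U).
    by rewrite (bigD1 i) //= lerDl sumr_ge0 // => j _; apply: enorm_ge0.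
  have -> : row i Q = row i (Q - s *: U) + s *: row i U.
    by rewrite [row i (_ - _)]linearB linearZ /= subrK.
  apply: le_trans (enormD _ _) _; rewrite enormZ (gtr0_norm sp).
  have := ler_wpM2l (ltW sp) UL; have := QU i; rewrite /L; lra.
split=> // z.
  have -> : z *m (N *m Q) *m B^T - s *: z = z *m N *m (Q - s *: U) *m B^T.
    rewrite !mulmxBr mulmxBl !mulmxA; congr (_ - _).
    by rewrite -!scalemxAr -scalemxAl -!mulmxA mulVmx // mulmx1.
  apply: le_trans (bP _) _.
  apply: le_trans (ler_wpM2l b0 (mulmx_rows_le QU _)) _.
  have ke : 0 <= k%:R * (eta * s) by rewrite !mulr_ge0 // ltW.
  apply: le_trans (ler_wpM2l b0 (ler_wpM2l ke (c0P z))) _.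
  have -> : b * (k%:R * (eta * s) * (c0 * enorm z)) =
      k%:R * c0 * b * eta * (s * enorm z) by ring.
  have sz : 0 <= s * enorm z by rewrite mulr_ge0 ?enorm_ge0 // ltW.
  have := ler_wpM2r sz etaP; lra.
rewrite mulmxA; apply: le_trans (mulmx_rows_le QL _) _.
have kl : 0 <= k%:R * (L * s) by rewrite !mulr_ge0 // ltW.
apply: le_trans (ler_wpM2l kl (c0P z)) _.
by rewrite le_eqVlt; apply/orP; left; apply/eqP; ring.
Qed.

(* G inverts the projection w |-> w *m B^T on the span of the tangent cone. *)
Lemma charts : exists2 delta : R, 0 < delta & exists2 K : R, 0 <= K &
  forall x, T_k A k x -> enorm (x - a) < delta ->
  exists G : 'M[R]_(k, d),
    (forall w, Tan A x w -> w *m B^T *m G = w) /\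
    forall z, enorm (z *m G) <= K * enorm z.
Proof.
have [c0 c00 c0P] := mulmx_bounded N; have [b b0 bP] := mulmx_bounded B^T.
have [delta [s0 [L [c [delta0 s00 L0 c_ge0 h]]]]] := adapted_frames.
exists delta => //; exists (2 * (c + 1)).
  by rewrite mulr_ge0 // addr_ge0.
move=> x [Ax [M [freeM TM _]]] xa.
set D := k%:R * C * L ^+ 2 * c0.
have D0 : 0 <= D by rewrite !mulr_ge0 ?sqr_ge0.
have [s [sp ss sL sD sDb]] : exists s : R, [/\ 0 < s, s <= s0, L * s <= eps / 2,
    D * s <= 1 & D * b * s <= 1 / 4].
  (* The sum of the reciprocals of all upper bounds required of [s]; its inverse meets them all at
     once. *)
  set E := 2 * L / eps + D + 4 * (D * b) + s0^-1.
  have i0 : 0 < s0^-1 by rewrite invr_gt0.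
  have Db : 0 <= D * b by rewrite mulr_ge0.
  have Le : 0 <= 2 * L / eps by rewrite divr_ge0 ?mulr_ge0 // ltW.
  have E0 : 0 < E by rewrite /E; lra.
  have le (t : R) : t <= E -> t * E^-1 <= 1.
    by move=> tE; rewrite ler_pdivrMr // mul1r.
  exists E^-1; split.
  - by rewrite invr_gt0.
  - by rewrite -[leRHS]invrK lef_pV2 ?posrE // /E; lra.
  - have := le (2 * L / eps); rewrite {1}/E => /(_ ltac:(lra)).
    have -> : 2 * L / eps * E^-1 = (2 * (L * E^-1)) / eps by ring.
    by rewrite ler_pdivrMr // mul1r; lra.
  - by apply: le; rewrite /E; lra.
  - have := le (4 * (D * b)); rewrite {1}/E => /(_ ltac:(lra)); lra.
have [Q [AQ QL QB Qc]] := h x Ax xa s ltac:(by rewrite sp ss).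
(* Replacing the rows of [Q] by tangent vectors at [x] costs O(s^2), against a frame of size [s];
   for small [s] their projections remain independent. *)
have /choice[w wP] (i : 'I_k) : exists w, Tan A x w /\
    enorm (w - row i Q) <= C * L ^+ 2 * s ^+ 2.
  have E : x + row i Q - x = row i Q by rewrite addrC addKr.
  have [|w Tw] := Tan_approx Ax (AQ i).
    by rewrite E; apply: le_trans (QL i) sL.
  rewrite E => we; exists w; split => //; apply: le_trans we _.
  rewrite -mulrA ler_wpM2l // -exprMn.
  exact: ler_sqr2 (enorm_ge0 _) (QL i).
pose W : 'M[R]_(k, d) := \matrix_i w i.
have WM : (W <= M)%MS.
  by apply/row_subP => i; rewrite rowK; apply: TM; have [] := wP i.
have WQ z : enorm (z *m (N *m (W - Q))) <= D * s ^+ 2 * enorm z.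
  have WQi i : enorm (row i (W - Q)) <= C * L ^+ 2 * s ^+ 2.
    by rewrite linearB /= rowK; have [] := wP i.
  rewrite mulmxA; apply: le_trans (mulmx_rows_le WQi _) _.
  have kl : 0 <= k%:R * (C * L ^+ 2 * s ^+ 2) by rewrite !mulr_ge0 ?(ltW sp).
  apply: le_trans (ler_wpM2l kl (c0P z)) _.
  by rewrite le_eqVlt; apply/orP; left; apply/eqP; rewrite /D; ring.
pose X := s^-1 *: (N *m W *m B^T).
have [|unitX Xinv] := @near_identity_inv _ _ X.
  move=> z.
  have -> : z *m X - z = s^-1 *: ((z *m (N *m Q) *m B^T - s *: z) +
      z *m (N *m (W - Q)) *m B^T).
    rewrite !mulmxBr mulmxBl [X in s^-1 *: X]addrC addrA subrK scalerBr scalerA.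
    by rewrite mulVf ?gt_eqF // scale1r /X -scalemxAr !mulmxA.
  rewrite enormZ gtr0_norm ?invr_gt0 // ler_pdivrMl //.
  apply: le_trans (enormD _ _) _.
  have h1 := QB z; have h2 := ler_wpM2l b0 (WQ z).
  have h3 := le_trans (bP _) h2.
  have sz : 0 <= s * enorm z by rewrite mulr_ge0 ?enorm_ge0 // ltW.
  have h4 := ler_wpM2r sz sDb; lra.
have /submxP[Y WY] := WM.
(* Here the span at [x] has dimension exactly [k]: the invertible [X] factors through the square
   matrix [M *m B^T]. *)
have unitMB : M *m B^T \in unitmx.
  move: unitX; rewrite /X WY !mulmxA -(mulmxA (N *m Y)) scalemxAl unitmx_mul.
  by case/andP.
pose G := invmx (M *m B^T) *m M.
have MG : M *m B^T *m G = M by rewrite /G mulmxA mulmxV // mul1mx.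
exists G; split.
  by move=> v /TM/submxP[y ->]; rewrite -(mulmxA y M B^T) -(mulmxA y (M *m B^T) G) MG.
move=> z.
have -> : z *m G = s^-1 *: (z *m invmx X *m (N *m W)).
  have WG : W *m B^T *m G = W by rewrite WY -(mulmxA Y M B^T) -(mulmxA Y (M *m B^T) G) MG.
  have -> : z *m G = z *m invmx X *m X *m G by rewrite mulmxKV.
  move: (z *m invmx X) => y.
  by rewrite -{1}WG /X -scalemxAr -scalemxAl !mulmxA.
rewrite enormZ gtr0_norm ?invr_gt0 // ler_pdivrMl //.
move: (z *m invmx X) (Xinv z) => y yz.
have -> : y *m (N *m W) = y *m (N *m Q) + y *m (N *m (W - Q)).
  by rewrite !mulmxBr addrC subrK.
apply: le_trans (enormD _ _) _.
have h1 := Qc y; have h2 := WQ y.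
have sy : 0 <= s * enorm y by rewrite mulr_ge0 ?enorm_ge0 // ltW.
have h3 := ler_wpM2r sy sD.
have cs : 0 <= s * (c + 1) by rewrite mulr_ge0 ?(ltW sp) // addr_ge0.
have h4 := ler_wpM2l cs yz; lra.
Qed.

(** Tangent vectors at [x] are fixed by w -> w B^T G x, so this map moves y - x by O(|y - x|^2) for
    [y] in [A]. For the Lipschitz bound, a frame at [x] of size s = |x - y| is nearly fixed by the
    maps of both [x] and [y], with error O(s^2); division by [s] leaves O(s). *)
Lemma jets : exists (delta K : R) (G : 'rV[R]_d -> 'M[R]_(k, d)),
  [/\ 0 < delta, 0 <= K,
    forall x y, (T_k A k `&` eball a delta) x -> (T_k A k `&` eball a delta) y ->
      enorm (y - x - (y - x) *m B^T *m G x) <= K * enorm ((y - x) *m B^T) ^+ 2 &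
    forall x y u, (T_k A k `&` eball a delta) x -> (T_k A k `&` eball a delta) y ->
      enorm (u *m (G x - G y)) <= K * enorm ((x - y) *m B^T) * enorm u].
Proof.
have [c0 c00 c0P] := mulmx_bounded N; have [b b0 bP] := mulmx_bounded B^T.
have [de1 [s0 [L [c [de10 s00 L0 c_ge0 h]]]]] := adapted_frames.
have [de2 de20 [Kg Kg0 chart]] := charts.
have /choice[G GP] (x : 'rV[R]_d) : exists G : 'M[R]_(k, d),
    T_k A k x -> enorm (x - a) < de2 ->
    (forall w, Tan A x w -> w *m B^T *m G = w) /\
    forall z, enorm (z *m G) <= Kg * enorm z.
  have [[Tx xa]|nx] := pselect (T_k A k x /\ enorm (x - a) < de2).
    by have [G GP] := chart x Tx xa; exists G.
  by exists 0 => Tx xa; case: nx.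
set Kr := (1 + b * Kg) * C.
have Kr0 : 0 <= Kr by rewrite mulr_ge0 // addr_ge0 // mulr_ge0.
set E := de1^-1 + de2^-1 + 2 * s0^-1 + 4 * (L + 1) / eps + 4 * Kr.
have de1i : 0 < de1^-1 by rewrite invr_gt0.
have de2i : 0 < de2^-1 by rewrite invr_gt0.
have s0i : 0 < s0^-1 by rewrite invr_gt0.
have Lei : 0 < 4 * (L + 1) / eps by rewrite divr_gt0 // mulr_gt0 // ltr_wpDl.
have E0 : 0 < E by rewrite /E; lra.
pose delta := E^-1.
have delta0 : 0 < delta by rewrite invr_gt0.
have le (t : R) : t <= E -> t * delta <= 1.
  by move=> tE; rewrite ler_pdivrMr // mul1r.
have dd1 : delta <= de1 by rewrite -[leRHS]invrK lef_pV2 ?posrE // /E; lra.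
have dd2 : delta <= de2 by rewrite -[leRHS]invrK lef_pV2 ?posrE // /E; lra.
have ds0 : 2 * delta <= s0.
  have := le (2 * s0^-1); rewrite {1}/E => /(_ ltac:(lra)).
  by rewrite mulrAC ler_pdivrMr // mul1r.
have dL : (L + 1) * (2 * delta) <= eps / 2.
  have := le (4 * (L + 1) / eps); rewrite {1}/E => /(_ ltac:(lra)).
  rewrite (mulrAC _ eps^-1) ler_pdivrMr // mul1r; lra.
have dKr : Kr * (2 * delta) <= 1 / 2.
  have := le (4 * Kr); rewrite {1}/E => /(_ ltac:(lra)); lra.
clearbody delta; clear E E0 le Lei.
have deps : 2 * delta <= eps / 2.
  by have : 0 <= L * delta by [rewrite mulr_ge0 // ltW]; lra.
have res x y : T_k A k x -> enorm (x - a) < delta -> A y -> enorm (y - x) <= eps / 2 ->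
    enorm (y - x - (y - x) *m B^T *m G x) <= Kr * enorm (y - x) ^+ 2.
  move=> Tx xa Ay xy; have [Ax _] := Tx.
  have [GT Gb] := GP x Tx (lt_le_trans xa dd2).
  have [w Tw we] := Tan_approx Ax Ay xy.
  move: (y - x) we => v we.
  have -> : v - v *m B^T *m G x = (w - v) *m B^T *m G x - (w - v).
    by rewrite !mulmxBl (GT w Tw) opprB [RHS]addrC addrA subrK.
  apply: le_trans (enormB _ _) _.
  apply: le_trans (lerD (Gb _) (lexx _)) _.
  have h1 := ler_wpM2l Kg0 (bP (w - v)).
  have kb : 0 <= 1 + b * Kg by rewrite addr_ge0 // mulr_ge0.
  have := ler_wpM2l kb we; rewrite /Kr; move: h1; lra.
have dist x y : (T_k A k `&` eball a delta) x -> (T_k A k `&` eball a delta) y ->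
    enorm (y - x) <= 2 * delta.
  move=> [_ /= xa] [_ /= ya]; have := enorm_dist a y x; rewrite (enormC a x).
  by move: xa ya; rewrite /eball /=; lra.
(* By [dKr] the quadratic residual is at most half of |y - x| and is absorbed: the projection is
   injective on the local piece of T_k(A), with Lipschitz inverse. *)
have lip x y : (T_k A k `&` eball a delta) x -> (T_k A k `&` eball a delta) y ->
    enorm (y - x) <= 2 * Kg * enorm ((y - x) *m B^T).
  move=> Px Py; have xy := dist x y Px Py; have [Tx xa] := Px; have [Ty _] := Py.
  have := res x y Tx xa Ty.1 ltac:(lra).
  have [_ Gb] := GP x Tx (lt_le_trans xa dd2).
  have := Gb ((y - x) *m B^T).
  have := enormD (y - x - (y - x) *m B^T *m G x) ((y - x) *m B^T *m G x).
  rewrite subrK.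
  have := ler_wpM2r (enorm_ge0 (y - x)) (le_trans (ler_wpM2l Kr0 xy) dKr).
  lra.
set K1 := Kr * (2 * Kg) ^+ 2.
(* The three squares bound the residuals of the steps from [x] to x + q_i, from [y] to x + q_i, and
   from [y] to [x], where q_i is row [i] of the frame. *)
set C3 := Kr * (L ^+ 2 + (L + 1) ^+ 2 + 1).
set K2 := 2 * (k%:R * C3 * c0) * (2 * Kg).
have K10 : 0 <= K1 by rewrite mulr_ge0 ?sqr_ge0.
have C30 : 0 <= C3 by rewrite mulr_ge0 // !addr_ge0 ?sqr_ge0.
have kC3 : 0 <= 2 * (k%:R * C3 * c0).
  by apply: mulr_ge0 => //; apply: mulr_ge0 => //; apply: mulr_ge0.
have K20 : 0 <= K2 by apply: mulr_ge0 => //; apply: mulr_ge0.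
exists delta, (K1 + K2), G; split => //; first by rewrite addr_ge0.
  move=> x y Px Py; have xy := dist x y Px Py; have [Tx xa] := Px; have [Ty _] := Py.
  have := res x y Tx xa Ty.1 ltac:(lra).
  have h1 := ler_sqr2 (enorm_ge0 _) (lip x y Px Py); rewrite exprMn in h1.
  have := ler_wpM2l Kr0 h1.
  have := mulr_ge0 K20 (sqr_ge0 (enorm ((y - x) *m B^T))).
  rewrite /K1; lra.
move=> x y u Px Py.
have [->|nxy] := eqVneq x y.
  by rewrite !subrr mulmx0 mul0mx !enorm0 mulr0 mul0r.
have sp : 0 < enorm (x - y) by rewrite enorm_gt0 // subr_eq0.
have xy := dist y x Py Px; have [Tx xa] := Px; have [Ty ya] := Py.
have sl := lip y x Py Px.
have [Q [AQ QL QB _]] := h x Tx.1 (lt_le_trans xa dd1) (enorm (x - y))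
  ltac:(by rewrite sp (le_trans xy)).
set s := enorm (x - y) in sp xy sl QL QB *.
have Ls : (L + 1) * s <= eps / 2.
  by apply: le_trans dL; rewrite ler_wpM2l // addr_ge0.
have rows i : enorm (row i (Q *m B^T *m (G x - G y))) <= C3 * s ^+ 2.
  rewrite !row_mul; have E : x + row i Q - x = row i Q by rewrite addrC addKr.
  have E' : x + row i Q - y = row i Q + (x - y) by rewrite addrAC addrC.
  have Qe : enorm (row i Q) <= eps / 2 by move: (QL i) Ls sp; lra.
  have := res x _ Tx xa (AQ i); rewrite E => /(_ Qe) r1.
  have qy : enorm (x + row i Q - y) <= (L + 1) * s.
    by rewrite E'; apply: le_trans (enormD _ _) _; have := QL i; rewrite -/s; lra.
  have := res y _ Ty ya (AQ i) (le_trans qy Ls) => r2.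
  have := res y x Ty ya Tx.1 (le_trans xy deps); rewrite -/s => r3.
  have -> : row i Q *m B^T *m (G x - G y) =
      (x + row i Q - y - (x + row i Q - y) *m B^T *m G y)
      - (x - y - (x - y) *m B^T *m G y) - (row i Q - row i Q *m B^T *m G x).
    rewrite E' mulmxBr !mulmxDl; apply/rowP => j; rewrite !mxE; ring.
  apply: le_trans (enormB _ _) _; apply: le_trans (lerD (enormB _ _) (lexx _)) _.
  have q1 := ler_wpM2l Kr0 (ler_sqr2 (enorm_ge0 _) (QL i)).
  have q2 := ler_wpM2l Kr0 (ler_sqr2 (enorm_ge0 _) qy).
  rewrite !exprMn in q1 q2; rewrite /C3; lra.
pose X := s^-1 *: (N *m Q *m B^T).
have [|unitX Xinv] := @near_identity_inv _ _ X.
  move=> z; have -> : z *m X - z = s^-1 *: (z *m (N *m Q) *m B^T - s *: z).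
    rewrite scalerBr scalerA mulVf ?gt_eqF // scale1r /X -scalemxAr !mulmxA //.
  rewrite enormZ gtr0_norm ?invr_gt0 // ler_pdivrMl //.
  apply: le_trans (QB z) _.
  have : 0 <= s * enorm z by rewrite mulr_ge0 ?enorm_ge0 // ltW.
  lra.
(* Any [u] is a combination of the projected frame vectors with coefficients O(|u| / s), so the
   bound on [rows] passes to [u]. *)
have -> : u *m (G x - G y) = s^-1 *: (u *m invmx X *m N *m (Q *m B^T *m (G x - G y))).
  have -> : u *m (G x - G y) = u *m invmx X *m X *m (G x - G y) by rewrite mulmxKV.
  move: (u *m invmx X) => v.
  by rewrite /X -scalemxAr -scalemxAl !mulmxA.
rewrite enormZ gtr0_norm ?invr_gt0 // ler_pdivrMl //.
apply: le_trans (mulmx_rows_le rows _) _.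
have kc : 0 <= k%:R * (C3 * s ^+ 2).
  by apply: mulr_ge0 => //; apply: mulr_ge0 => //; apply: sqr_ge0.
have h1 := le_trans (c0P (u *m invmx X)) (ler_wpM2l c00 (Xinv u)).
apply: le_trans (ler_wpM2l kc h1) _.
set t := enorm ((x - y) *m B^T) in sl *.
have uc : 0 <= s * (2 * (k%:R * C3 * c0)) * enorm u.
  exact: mulr_ge0 (mulr_ge0 (ltW sp) kC3) (enorm_ge0 u).
have := ler_wpM2l uc sl.
have : 0 <= s * (K1 * t * enorm u).
  exact: mulr_ge0 (ltW sp) (mulr_ge0 (mulr_ge0 K10 (enorm_ge0 _)) (enorm_ge0 u)).
rewrite /K2; lra.
Qed.

End Jets.

(** * The surface obtained by extending the jet of T_k(A) *)

Unset Implicit Arguments.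

Theorem theorem4p1 (R : realType) (d k : nat) (A : set 'rV[R]_d) (a : 'rV[R]_d) :
  (2 <= d)%N -> (1 <= k)%N -> (k <= d - 1)%N ->
  positive_reach A -> T_k A k a ->
  exists (delta : R) (G : set 'rV[R]_d),
    0 < delta /\ C11_surface k G /\ T_k A k `&` eball a delta `<=` G.
Proof.
move=> _ _ _ [eps [eps0 reachA]] Ta; have [Aa spana] := Ta.
have /choice[proj projA] (x : 'rV[R]_d) : exists p, tube A eps x ->
    nearest A x p /\ forall p', nearest A x p' -> p' = p.
  have [tx|ntx] := pselect (tube A eps x); last by exists 0.
  by have [p hp] := reachA x tx; exists p.
have projP x (tx : tube A eps x) := (projA x tx).1.
have proj_unique x p (tx : tube A eps x) := (projA x tx).2 p.
have C0 : 0 <= 2 / eps by rewrite divr_ge0 // ltW.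
have [U freeU TanU] := span_dim_basis spana.
have [B BB unitUB] := coordinate_projection freeU.
have [delta [K [G [delta0 K0 jet1 jet2]]]] := jets eps0 C0
  (reach_Tan eps0 projP proj_unique)
  (fun u eta => @reach_Tan_points _ _ _ _ eps0 _ projP proj_unique a u eta Aa)
  TanU unitUB.
(* The jet is indexed by the points themselves: node x B^T, value [x], derivative [G x]. The matrix
   [1%:M - B^T *m B] is the orthogonal projection onto the complement of W. *)
have [||y z Py Pz|y z u Py Pz|F FC11 FE] := @C11_jet_extension R k d _
  (T_k A k `&` eball a delta) (fun x => x *m B^T) id G (1%:M - B^T *m B) K.
- by exists a; split => //; rewrite /eball /= subrr enorm0.
- exact: K0.
- by rewrite -mulmxBl; apply: jet1.
- by rewrite -mulmxBl; apply: jet2.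
exists delta, [set y | exists v, y = v *m B + F v *m (1%:M - B^T *m B)].
split => //; split.
  exists B, (fun v => F v *m (1%:M - B^T *m B)); split => // v.
  by rewrite -mulmxA mulmxBl mul1mx -mulmxA BB mulmx1 subrr mulmx0.
(* F recovers [x] from its projection, so the surface point over x B^T is x B^T B + x (1 - B^T B) =
   x. *)
move=> x Px /=; exists (x *m B^T); rewrite FE // mulmxBr mulmx1 mulmxA.
by rewrite addrC subrK.
Qed.
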